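(* Let $\Omega\subset D=[0,1]^2$ be a domain of class $\mathcal C^s$ with $s\ge 1$ and let $u=\chi_\Omega$. Then the LVIRA method, i.e. the recovery by $\ell^2$ minimization based on linear interfaces on $3\times 3$ stencils, converges in $L^1$ norm at rate $\mathcal O(h^r)$ with $r=\min\{s,2\}$: there is a constant $C$ independent of $h$ such that the global reconstruction $\tilde u$ of $u$ from its cell averages on the mesh of side length $h$ satisfies $$\|u-\tilde u\|_{L^1(D)}\le C h^r .$$
   Context: **Mesh and cell averages.** For $h=1/N_0$ with an integer $N_0>1$, $\mathcal T_h$ is the set of the cells $T=h(k+[0,1]^2)$, $k\in\{0,\dots,N_0-1\}^2$, which partition $D$. The cell average is $a_T(u)=\frac1{|T|}\int_T u$. A cell $T$ is singular if $|T\cap\Omega|\ne0$ and $|T\cap\Omega^c|\neq 0$, equivalently $0<a_T(u)<1$; $\mathcal S_h$ denotes the set of singular cells and the other cells are called regular. For cells near $\partial D$, stencils are taken in the extended grid $h(k+[0,1]^2)$, $k\in\mathbb Z^2$, with $u=\chi_\Omega$ viewed as a function on $\mathbb R^2$. **Method.** For a regular cell, $\tilde u_T$ is the constant $a_T(u)\in\{0,1\}$. For a singular cell $T$, let $S$ be the $3\times3$ stencil of cells centered at $T$, let $V_2$ be the set of functions $\chi_H$ with $H$ a half-plane whose boundary line passes through $T$, and let $\tilde u_T$ be any element of $\operatorname{arg\,min}_{v\in V_2}\|a_S(v)-a_S(u)\|_{\ell^2}$, where $a_S(v)=(a_{\tilde T}(v))_{\tilde T\in S}\in\mathbb R^9$.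 The global reconstruction is $\tilde u=\sum_{T\in\mathcal T_h}\tilde u_T\chi_T$. **$\mathcal C^s$ domains.** A domain $\Omega\subset\mathbb R^2$ is of class $\mathcal C^s$, $s>0$, if there exist $R>0$, $P>1$, $M>0$ such that for every $z_0\in\partial\Omega$ there exist an orthonormal system $(e_1,e_2)$ and a function $\psi\in\mathcal C^s([-R,R])$ with $\|\psi\|_{\mathcal C^s}\le M$, with values in $[-PR,PR]$, such that $z\in\Omega\iff z_2\le\psi(z_1)$ for any $z=z_0+z_1e_1+z_2e_2$ with $|z_1|\le R$ and $|z_2|\le PR$. Here $$\|\psi\|_{\mathcal C^s}=\sup_{0\le k\le\lfloor s\rfloor}\|\psi^{(k)}\|_{L^\infty([-R,R])}+\sup_{x\ne t\in[-R,R]}|x-t|^{\lfloor s\rfloor-s}\,|\psi^{(\lfloor s\rfloor)}(x)-\psi^{(\lfloor s\rfloor)}(t)|$$ for non-integer $s$; for integer $s$, $\mathcal C^s$ denotes the functions with Lipschitz derivatives up to order $s-1$, with the corresponding norm (so $s=1$ corresponds to Lipschitz domains). *)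

(* Defs.v *)
From HB Require Import structures.
From mathcomp Require Import all_boot all_order all_algebra.
From mathcomp Require Import all_classical all_reals all_analysis.

Set Implicit Arguments.
Unset Strict Implicit.
Unset Printing Implicit Defensive.

Import Order.TTheory GRing.Theory Num.Theory.
Import numFieldNormedType.Exports.

Local Open Scope classical_set_scope.
Local Open Scope ring_scope.

Section Norms.
Context {R : realType}.

(* The restriction f \_ D vanishes outside D, the default point of R being 0. *)
Definition Lnorm_on {d} {T : measurableType d} (mu : {measure set T -> \bar R})
  (D : set T) (p : \bar R) (f : T -> R) : \bar R :=
  'N[mu]_p [EFin \o (f \_ D)].

(* The derivative relative to I: one-sided at the endpoints of an interval.  It
   only depends on the values of f on I, when x is in I. *)
Definition diff_quot_in (I : set R) (f : R -> R) (x : R) : set_system R :=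
  (fun t => (t - x)^-1 * (f t - f x)) @ within I x^'.

Definition derive_in (I : set R) (f : R -> R) (x : R) : R :=
  lim (diff_quot_in I f x).

Definition derive_in_n (I : set R) (k : nat) (f : R -> R) : R -> R :=
  iter k (derive_in I) f.

Definition differentiable_in_n (I : set R) (m : nat) (f : R -> R) : Prop :=
  forall k : nat, (k < m)%N -> forall x, I x ->
    cvg (diff_quot_in I (derive_in_n I k f) x).

(* Number of classical derivatives of a C^s function: for an integer s, C^s
   stands for C^{s-1,1}, so that the Hoelder exponent s - Cs_order s always
   lies in ]0, 1]. *)
Definition Cs_order (s : R) : nat :=
  if s \is a Num.nat then (Num.truncn s).-1 else Num.truncn s.

Definition Cs_norm (s : R) (I : set R) (f : R -> R) : \bar R :=
  let m := Cs_order s in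
  (ereal_sup [set Lnorm_on lebesgue_measure I +oo (derive_in_n I k f) |
                k in [set k : nat | (k <= m)%N]] +
   ereal_sup [set (`|xt.1 - xt.2| `^ (m%:R - s) *
                   `|derive_in_n I m f xt.1 - derive_in_n I m f xt.2|)%:E |
                xt in [set xt : R * R | [/\ I xt.1, I xt.2 & xt.1 != xt.2]]])%E.

Definition is_Cs (s : R) (I : set R) (f : R -> R) : Prop :=
  differentiable_in_n I (Cs_order s) f /\ (Cs_norm s I f < +oo)%E.

End Norms.

Section Plane.
Context {R : realType}.
Implicit Types (z e n : R * R) (Omega T D : set (R * R)).

Definition dot z e : R := z.1 * e.1 + z.2 * e.2.

Definition orthonormal_system e1 e2 : Prop :=
  [/\ dot e1 e1 = 1, dot e2 e2 = 1 & dot e1 e2 = 0].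

Definition frontier Omega : set (R * R) := closure Omega `\` interior Omega.

Definition Cs_domain (s : R) Omega : Prop :=
  exists r P M : R, [/\ 0 < r, 1 < P, 0 < M &
    forall z0, frontier Omega z0 ->
      exists e1 e2 (psi : R -> R),
        [/\ orthonormal_system e1 e2,
            is_Cs s `[- r, r] psi,
            (Cs_norm s `[(- r)%R, r] psi <= M%:E)%E,
            (forall x, `|x| <= r -> `|psi x| <= P * r) &
            forall x y : R, `|x| <= r -> `|y| <= P * r ->
              (Omega (z0 + x *: e1 + y *: e2) <-> y <= psi x)]].

(* measurableTypeR R is R itself, with the Borel sigma-algebra carried by
   lebesgue_measure. *)
Definition area :
    {measure set (measurableTypeR R * measurableTypeR R) -> \bar R} :=
  (@lebesgue_measure R \x @lebesgue_measure R)%E.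

Definition unit_square : set (R * R) := `[0, 1] `*` `[0, 1].

Definition cell (h : R) (k : int * int) : set (R * R) :=
  `[h * k.1%:~R, h * (k.1 + 1)%:~R] `*` `[h * k.2%:~R, h * (k.2 + 1)%:~R].

Definition average T (v : R * R -> R) : R :=
  (fine (area T))^-1 * \int[area]_(z in T) v z.

Definition singular T Omega : Prop :=
  area (T `&` Omega) != 0%E /\ area (T `&` ~` Omega) != 0%E.

Definition stencil_cell (h : R) (k : int * int) (i j : 'I_3) : set (R * R) :=
  cell h (k.1 + i%:Z - 1, k.2 + j%:Z - 1).

Definition stencil_averages (h : R) (k : int * int) (v : R * R -> R) : 'M[R]_3 :=
  \matrix_(i, j) average (stencil_cell h k i j) v.

Definition l2norm (A : 'M[R]_3) : R := Num.sqrt (\sum_i \sum_j A i j ^+ 2).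

(* Both the open and the closed half-planes are allowed. *)
Definition half_plane n (c : R) (H : set (R * R)) : Prop :=
  n != 0 /\ (H = [set z | dot n z <= c] \/ H = [set z | dot n z < c]).

Definition linear_interfaces T : set (R * R -> R) :=
  [set v | exists n c H, [/\ half_plane n c H,
     [set z | dot n z = c] `&` T !=set0 & v = \1_H]].

Definition argmin {X : Type} (V : set X) (F : X -> R) : set X :=
  [set v | V v /\ forall w, V w -> F v <= F w].

Definition lvira_local (h : R) (k : int * int) Omega : set (R * R -> R) :=
  let u : R * R -> R := \1_Omega in
  [set v | (singular (cell h k) Omega ->
              argmin (linear_interfaces (cell h k))
                (fun w => l2norm (stencil_averages h k w - stencil_averages h k u)) v)
        /\ (~ singular (cell h k) Omega ->
              v = cst (average (cell h k) u))].

Definition mesh_index {N : nat} (k : 'I_N * 'I_N) : int * int :=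
  (k.1%:Z, k.2%:Z).

(* The sum is taken over closed cells, which overlap only on a null set. *)
Definition global_reconstruction (N : nat) (h : R)
    (p : 'I_N * 'I_N -> R * R -> R) (z : R * R) : R :=
  \sum_k p k z * \1_(cell h (mesh_index k)) z.

End Plane.

(* Main.v *)
Require Import Defs.
From HB Require Import structures.
From mathcomp Require Import all_boot all_order all_algebra.
From mathcomp Require Import all_classical all_reals all_analysis.
From mathcomp Require Import measurable_realfun.
From mathcomp Require Import zify ring lra.
Import Order.TTheory GRing.Theory Num.Theory.
Import numFieldNormedType.Exports.
Local Open Scope classical_set_scope.
Local Open Scope ring_scope.

(** The error sits on the mesh cells that meet the frontier of Omega.

    There are O(1/h) of them: near each of its points the frontier is a
    Lipschitz graph, finitely many charts suffice by compactness, and in one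
    chart a slab of width h over the base meets boundedly many such cells
    ([singular_count]).  On a regular cell the reconstruction is exact up to a
    null set, and on a singular cell the error is at most h^2, which already
    gives the rate for s = 1.

    For s > 1, Taylor's formula shows that the half-plane H0 bounded by the
    tangent at a frontier point of the cell differs from Omega, within the
    stencil, by a part of a strip of width O(h^r); this part has area
    O(h^(1+r)) ([tangent_half_plane], [mass_strip]).  The fitted half-plane H
    reproduces the nine averages at least as well as H0 does, so that in each
    cell of the stencil the areas covered by H and by H0 differ by O(h^(1+r))
    ([lvira_error]).  Everything then rests on a stability estimate, which turns
    this into a bound for the symmetric difference of H and H0 in the central
    cell ([half_plane_stability]).

    The stability estimate has a short proof by translations.  Let
    H1 = {n1.z <= c1} and H2 = {n2.z <= c2} have boundary lines that meet the
    central cell T, let E bound the differences of the areas covered in the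
    nine cells, and put W+ = H1 \ H2 and W- = H2 \ H1.  If n1 and n2 lie in
    opposite closed quadrants, some corner cell is covered by H1 and missed by
    H2, so that E is at least the area of a cell.  If n1 and n2 are positively
    parallel, H1 and H2 are nested and T itself gives the bound.  In all other
    cases there are a signed coordinate vector e in the cone spanned by -n1 and
    n2, so that e.z <= e.w for z in W- and w in W+, and a vector d with
    sup norm 1, e.d = 1 and n1.d <= 0 <= n2.d, so that W+ is stable under the
    translation by h d ([normals_trichotomy]).  This translation moves T into
    the three cells next to T on the side of e.  As soon as W+ meets T, these
    cells contain no point of W- in their interior, so that each of them
    contains at most E of W+; hence T contains at most 3 E of W+.  The vectors
    -e and -d do the same for W-. *)

(** * Area of plane sets *)

Section AreaBasics.
Context {R : realType}.
Implicit Types (A X : set (R * R)) (z w n d : R * R).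
Local Notation RB := (measurableTypeR R).
Local Notation PB := (RB * RB)%type.
Local Notation lam := (@lebesgue_measure R).

Lemma measurable_addl (c : R) : measurable_fun setT (+%R c : RB -> RB).
Proof. exact: measurable_funD. Qed.

Lemma lebesgue_measure_translate (c : R) (A : set R) : measurable (A : set RB) ->
  lam ((+%R c) @^-1` A) = lam A.
Proof.
move=> mA; apply/esym.
apply: (@lebesgue_measure_unique _ (pushforward lam (+%R c : RB -> RB))) => //.
  exact: measurable_addl.
move=> ? _ [[a b]] _ <-; rewrite /= /pushforward.
have -> : +%R c @^-1` `]a, b]%classic = `](a - c)%R, (b - c)%R]%classic.
  by apply/seteqP; split=> x /=; rewrite !in_itv/= => /andP[]; lra.
rewrite !lebesgue_measure_itv/= !lte_fin ltrD2r.
by case: ifP => // _; rewrite !EFinN -!EFinD; congr EFin; lra.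
Qed.

Lemma area_box (i1 i2 : interval R) :
  area ([set` i1] `*` [set` i2]) = (lam [set` i1] * lam [set` i2])%E.
Proof. exact: product_measure1E. Qed.

Lemma measurable_dot n : measurable_fun setT (dot n : PB -> RB).
Proof.
by apply: measurable_funD; apply: measurable_funM.
Qed.

(** An open set of the plane is the union of the boxes with rational corners that it contains. *)
Lemma measurable_open A : open A -> measurable (A : set PB).
Proof.
move=> oA.
pose box (q : (rat * rat) * (rat * rat)) : set (R * R) :=
  [set` `]ratr q.1.1, ratr q.1.2[%R] `*` [set` `]ratr q.2.1, ratr q.2.2[%R].
have -> : A = \bigcup_q (if asbool (box q `<=` A) then box q else set0).
  apply/seteqP; split => [[x y] Axy|z [q _]]; last by case: asboolP => // qA /qA.
  have /nbhs_ballP[/= e e0 eA] : nbhs (x, y) A by apply: open_nbhs_nbhs.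
  have xe (t : R) : exists q : rat * rat, ratr q.1 < t < ratr q.2 /\
      t - e < ratr q.1 /\ ratr q.2 < t + e.
    have /rat_in_itvoo[p] : t - e < t by lra.
    have /rat_in_itvoo[q] : t < t + e by lra.
    rewrite !in_itv/= => /andP[q1 q2] /andP[p1 p2].
    by exists (p, q); rewrite p2 q1.
  have [p [/andP[p1 p2] [p3 p4]]] := xe x.
  have [q [/andP[q1 q2] [q3 q4]]] := xe y.
  exists (p, q) => //; case: asboolP; first by rewrite /box /= !in_itv/= p1 p2 q1 q2.
  case=> -[s t] [/=]; rewrite !in_itv/= => /andP[s1 s2] /andP[t1 t2].
  apply: eA; split => /=; rewrite /ball/= ltr_norml; lra.
apply: countable_bigcupT_measurable; first exact: countableP.
move=> q; case: asboolP => // _.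
by apply: measurableX.
Qed.

Lemma measurable_closed A : closed A -> measurable (A : set PB).
Proof.
move=> cA; rewrite -(setCK A); apply: measurableC; apply: measurable_open.
exact: closed_openC.
Qed.

Lemma measurable_half_plane n c A : half_plane n c A -> measurable (A : set PB).
Proof.
have mn := measurable_dot n.
case=> _ [] ->.
  have := mn measurableT `]-oo, c]%classic (measurable_itv _); rewrite setTI.
  congr (measurable _); apply/seteqP; split => z /=; by rewrite in_itv.
have := mn measurableT `]-oo, c[%classic (measurable_itv _); rewrite setTI.
congr (measurable _); apply/seteqP; split => z /=; by rewrite in_itv.
Qed.

Lemma measurable_translate d :
  measurable_fun setT ((fun z => (d.1 + z.1, d.2 + z.2)) : PB -> PB).
Proof. by apply/measurable_fun_pairP; split; apply: measurable_funD. Qed.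

(** The measure A |-> area (A - d) agrees with the product measure on rectangles. *)
Lemma area_translate d A : measurable (A : set PB) ->
  area [set z | A (d + z)] = area A.
Proof.
move=> mA.
have mf := measurable_translate d.
pose f : PB -> PB := fun z => (d.1 + z.1, d.2 + z.2).
apply/esym.
apply: (@product_measure_unique _ _ RB RB R lam lam (pushforward area f)) => //.
move=> B C mB mC.
rewrite /= /pushforward.
have -> : f @^-1` (B `*` C) = (+%R d.1 @^-1` B) `*` (+%R d.2 @^-1` C).
  by apply/seteqP; split => z.
transitivity (lam (+%R d.1 @^-1` B) * lam (+%R d.2 @^-1` C))%E; last first.
  by rewrite !lebesgue_measure_translate.
apply: product_measure1E.
- by rewrite -[X in measurable X]setTI; exact: measurable_addl.
- by rewrite -[X in measurable X]setTI; exact: measurable_addl.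
Qed.

Lemma integral_le_base (f : R -> \bar R) (a b M : R) :
  measurable_fun setT (f : RB -> \bar R) -> (forall x, (0 <= f x <= M%:E)%E) ->
  (forall x, ~ a <= x <= b -> f x = 0%E) -> a <= b -> 0 <= M ->
  (\int[lam]_x f x <= (M * (b - a))%:E)%E.
Proof.
move=> mf fM f0 ab M0.
have -> : (\int[lam]_x f x = \int[lam]_(x in `[a, b]) f x)%E.
  rewrite [RHS]integral_mkcond; apply: eq_integral => x _.
  rewrite patchE; case: ifPn => // xab; apply: f0 => xab'.
  by move: xab; rewrite notin_setE => -[]; rewrite /= in_itv.
apply: (@le_trans _ _ (\int[lam]_(x in `[a, b]) (cst M%:E) x)%E).
  apply: ge0_le_integral => //.
  - by move=> x _; have /andP[] := fM x.
  - exact: measurable_funTS mf.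
  - by move=> x _; have /andP[] := fM x.
have -> : (\int[lam]_(x in `[a, b]) (cst M%:E) x = M%:E * lam `[a, b])%E.
  exact: integral_cst.
rewrite lebesgue_measure_itv/= lte_fin EFinM.
case: ifP => // /negbT; rewrite -leNgt => ba.
by rewrite mule0 mule_ge0// lee_fin//; lra.
Qed.

Lemma area_le_xsection A (a b M : R) : measurable (A : set PB) ->
  A `<=` [set z | a <= z.1 <= b] -> a <= b -> 0 <= M ->
  (forall x, (lam (xsection A x) <= M%:E)%E) ->
  (area A <= (M * (b - a))%:E)%E.
Proof.
move=> mA Aab ab M0 AM; apply: (@integral_le_base (lam \o xsection A)) => //.
- exact: measurable_fun_xsection.
- by move=> x; apply/andP; split=> //=; exact: AM.
move=> x nx /=; rewrite (_ : xsection A x = set0) ?measure0//.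
by apply/seteqP; split => // y; rewrite /xsection/= inE => /Aab.
Qed.

(** Integrating in the other order gives the same measure of the plane, by uniqueness of the product measure. *)
Lemma area_le_ysection A (a b M : R) : measurable (A : set PB) ->
  A `<=` [set z | a <= z.2 <= b] -> a <= b -> 0 <= M ->
  (forall y, (lam (ysection A y) <= M%:E)%E) ->
  (area A <= (M * (b - a))%:E)%E.
Proof.
move=> mA Aab ab M0 AM.
have -> : area A = (lam \x^ lam)%E A.
  apply: (@product_measure_unique _ _ RB RB R lam lam) => //.
  by move=> B C mB mC; apply: product_measure2E.
apply: (@integral_le_base (lam \o ysection A)) => //.
- exact: measurable_fun_ysection.
- by move=> y; apply/andP; split=> //=; exact: AM.
move=> y ny /=; rewrite (_ : ysection A y = set0) ?measure0//.
by apply/seteqP; split => // x; rewrite /ysection/= inE => /Aab.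
Qed.

End AreaBasics.

(** * Directions that separate two half-planes *)

Section Directions.
Context {R : realType}.
Implicit Types (n e d v : R * R).

Definition axis_unit e : Prop :=
  exists2 s : int, s = 1 \/ s = -1 & e = (s%:~R, 0) \/ e = (0, s%:~R).

(** When the half-planes with outer normals [n1] and [n2] are H1 and H2, [d] is a
    direction in which H1 \ H2 is stable, and by the last clause [dot e] does
    not decrease from any point of H2 \ H1 to any point of H1 \ H2. *)
Definition escape_direction n1 n2 e d : Prop :=
  [/\ `|d.1| <= 1, `|d.2| <= 1, dot e d = 1, dot n1 d <= 0 <= dot n2 d &
      forall v, dot n1 v <= 0 -> 0 <= dot n2 v -> 0 <= dot e v].

(** Exchanging the half-planes exchanges the two parts of their symmetric difference. *)
Lemma escape_direction_sym n1 n2 e d : escape_direction n1 n2 e d ->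
  escape_direction n2 n1 (- e) (- d).
Proof.
rewrite /escape_direction /dot/= !normrN => -[d1 d2 ed /andP[n1d n2d] sep].
split=> //; first lra.
  by apply/andP; split; lra.
by move=> v v2 v1; have /= := sep (- v); rewrite /dot/=; lra.
Qed.

Lemma axis_unitN e : axis_unit e -> axis_unit (- e).
Proof.
case=> s hs he; exists (- s).
  by case: hs => ->; [right|left; rewrite opprK].
by case: he => ->; [left|right];
  rewrite [LHS]surjective_pairing /= oppr0 rmorphN.
Qed.

Let esc n1 n2 := exists2 e, axis_unit e & exists d, escape_direction n1 n2 e d.

Let esc_neg n1 n2 : esc (- n1) (- n2) -> esc n1 n2.
Proof.
case=> e ae [d [d1 d2 ed /andP[n1d n2d] sep]].
exists (- e); first exact: axis_unitN.
exists (- d); move: d1 d2 ed n1d n2d sep.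
rewrite /escape_direction /dot/= !normrN => d1 d2 ed n1d n2d sep.
split=> //; first lra.
  by apply/andP; split; lra.
by move=> v v1 v2; have /= := sep (- v); rewrite /=; lra.
Qed.

Let esc_swap n1 n2 : esc (n1.2, n1.1) (n2.2, n2.1) -> esc n1 n2.
Proof.
case=> e [s hs ae] [d [d1 d2 ed /andP[n1d n2d] sep]].
exists (e.2, e.1).
  by exists s => //; case: ae => ->; [right|left].
exists (d.2, d.1); move: d1 d2 ed n1d n2d sep.
rewrite /escape_direction /dot/= => d1 d2 ed n1d n2d sep.
split=> //; first lra.
  by apply/andP; split; lra.
by move=> v v1 v2; have /= := sep (v.2, v.1); rewrite /=; lra.
Qed.

(** With both normals pointing upwards, n1.2 n2 - n2.2 n1 is horizontal and lies in
    the cone spanned by -n1 and n2: its direction is [e].  The vector [d] is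
    (t, y) with t = 1 or t = -1 according to [e], where y may range between t times
    the slopes of the two boundary lines.  This interval meets [-1, 1] unless both
    lines are steep and lean to the same side. *)
Let esc_pos n1 n2 : 0 < n1.2 -> 0 < n2.2 ->
  `|n1.1| <= n1.2 \/ `|n2.1| <= n2.2 \/ n1.1 * n2.1 <= 0 ->
  n2.1 * n1.2 - n1.1 * n2.2 != 0 -> esc n1 n2.
Proof.
case: n1 n2 => [a1 b1] [a2 b2] /= b10 b20 small D0.
have key (s : int) : s = 1 \/ s = -1 ->
    0 < s%:~R * (a2 * b1 - a1 * b2) -> esc (a1, b1) (a2, b2).
  move=> hs; set t : R := s%:~R => tD.
  have tt : t * t = 1 by rewrite /t; case: hs => ->; rewrite /=; lra.
  exists (t, 0); first by exists s => //; left.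
  pose L := - (a2 * t) / b2; pose U := - (a1 * t) / b1.
  have Lb : L * b2 = - (a2 * t) by rewrite /L divfK// gt_eqF.
  have Ub : U * b1 = - (a1 * t) by rewrite /U divfK// gt_eqF.
  have LU : L < U.
    rewrite /L /U ltr_pdivrMr// mulrAC ltr_pdivlMr//; lra.
  have t1 : t = 1 \/ t = -1 by rewrite /t; case: hs => ->; [left|right].
  have [L1 U1] : L <= 1 /\ -1 <= U.
    rewrite /L /U ler_pdivrMr// ler_pdivlMr//.
    case: small; [rewrite ler_norml|case; [rewrite ler_norml|]] => H; case: t1 => E; move: tD H LU Lb Ub; rewrite E; nra.
  (* The least element of [L, U] that is at least -1. *)
  exists (t, Num.max L (-1)).
  have [M1 [M2 M3]] : -1 <= Num.max L (-1) /\ L <= Num.max L (-1) /\ Num.max L (-1) <= 1 /\ Num.max L (-1) <= U.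
    rewrite !le_max !ge_max; split; first by rewrite lexx orbT.
    by split; [rewrite lexx|split; apply/andP; split => //; lra].
  case: M3 => M3 M4.
  rewrite /escape_direction /dot/=; split.
  - by case: t1 => ->; rewrite ?normrN normr1.
  - by rewrite ler_norml M1 M3.
  - by lra.
  - apply/andP; split; nra.
  - move=> v v1 v2; rewrite mul0r addr0.
    have : 0 <= (a2 * b1 - a1 * b2) * v.1 by nra.
    by case: t1 tD => -> tD; nra.
move/lt_total : D0 => /orP[D0|D0].
  by apply: (key (-1)); [right|rewrite /=; lra].
by apply: (key 1); [left|rewrite /=; lra].
Qed.

Let esc_small n1 n2 : 0 < n1.2 * n2.2 ->
  `|n1.1| <= `|n1.2| \/ `|n2.1| <= `|n2.2| \/ n1.1 * n2.1 <= 0 ->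
  n2.1 * n1.2 - n1.1 * n2.2 != 0 -> esc n1 n2.
Proof.
move=> b0 small D0; have [b1|b1] := ltP 0 n1.2.
  have b2 : 0 < n2.2 by rewrite -(pmulr_rgt0 _ b1).
  by apply: esc_pos => //; move: small; rewrite (gtr0_norm b1) (gtr0_norm b2).
have b1' : n1.2 < 0 by rewrite lt_neqAle b1 andbT; apply: contraTneq b0 => ->; rewrite mul0r ltxx.
have b2 : n2.2 < 0 by rewrite -(nmulr_rgt0 _ b1').
apply/esc_neg/esc_pos => //=; rewrite ?oppr_gt0//.
- move: small; rewrite (ltr0_norm b1') (ltr0_norm b2) !normrN => -[|[]]; [left|right; left|right; right] => //.
  by rewrite mulrNN.
- by rewrite !mulrNN.
Qed.

(** Two lines that are both steep and lean to the same side become flat when the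
    coordinates are exchanged, so that one of the two axes always works in the third case. *)
Lemma normals_trichotomy n1 n2 :
  [\/ n1.1 * n2.1 <= 0 /\ n1.2 * n2.2 <= 0,
      exists2 l, 0 < l & n2 = l *: n1 |
      exists2 e, axis_unit e & exists d, escape_direction n1 n2 e d].
Proof.
have par (a1 b1 a2 b2 : R) : a2 * b1 - a1 * b2 = 0 -> 0 < b1 * b2 ->
    0 < b2 / b1 /\ a2 = (b2 / b1) * a1 /\ b2 = (b2 / b1) * b1.
  move=> D0 bb; have b1N0 : b1 != 0 by apply: contraTneq bb => ->; rewrite mul0r ltxx.
  split; first by rewrite (_ : _ / _ = (b1 * b2) / b1 ^+ 2);
    [rewrite divr_gt0// exprn_even_gt0|field].
  split; last by rewrite divfK.
  have {}D0 : a2 * b1 = a1 * b2 by lra.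
  by rewrite mulrAC (mulrC b2) -D0 mulfK.
have [D0|D0] := eqVneq (n2.1 * n1.2 - n1.1 * n2.2) 0.
  have [b0|b0] := ltP 0 (n1.2 * n2.2).
    have [l0 [e1 e2]] := par _ _ _ _ D0 b0.
    constructor 2; exists (n2.2 / n1.2) => //.
    by rewrite [LHS]surjective_pairing [RHS]surjective_pairing; congr pair.
  have [a0|a0] := ltP 0 (n1.1 * n2.1); last by constructor 1.
  have D0' : n2.2 * n1.1 - n1.2 * n2.1 = 0 by lra.
  have [l0 [e1 e2]] := par _ _ _ _ D0' a0.
  constructor 2; exists (n2.1 / n1.1) => //.
  by rewrite [LHS]surjective_pairing [RHS]surjective_pairing; congr pair.
have D0' : n2.2 * n1.1 - n1.2 * n2.1 != 0.
  by rewrite -oppr_eq0 opprB (mulrC n1.2) (mulrC n2.2).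
have [b0|b0] := ltP 0 (n1.2 * n2.2); have [a0|a0] := ltP 0 (n1.1 * n2.1).
- have [|h] := leP `|n1.1| `|n1.2|.
    by move=> ?; constructor 3; apply: esc_small => //; left.
  constructor 3; apply: esc_swap; apply: esc_small => //=.
  by left; apply: ltW.
- by constructor 3; apply: esc_small => //; right; right.
- by constructor 3; apply: esc_swap; apply: esc_small => //=; right; right.
- by constructor 1.
Qed.

End Directions.

(** * Area inside the cells of a grid *)

Section CellMass.
Context {R : realType}.
Implicit Types (A B W : set (R * R)) (z w n d : R * R) (h : R) (k : int * int).
Local Notation RB := (measurableTypeR R).
Local Notation PB := (RB * RB)%type.
Local Notation lam := (@lebesgue_measure R).

(** Areas are measured in open cells, as points of distinct cells then satisfy
    strict inequalities; the lines of the grid are negligible. *)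
Definition open_cell h k : set (R * R) :=
  `]h * k.1%:~R, h * (k.1 + 1)%:~R[ `*` `]h * k.2%:~R, h * (k.2 + 1)%:~R[.

Definition mass h k A : R := fine (area (open_cell h k `&` A)).

Lemma open_cellP h k z : open_cell h k z <->
  (h * k.1%:~R < z.1 < h * k.1%:~R + h) /\ (h * k.2%:~R < z.2 < h * k.2%:~R + h).
Proof.
by rewrite /open_cell /= !in_itv/= !intrD !mulrDr !mulr1.
Qed.

Lemma cellP h k z : cell h k z <->
  (h * k.1%:~R <= z.1 <= h * k.1%:~R + h) /\
  (h * k.2%:~R <= z.2 <= h * k.2%:~R + h).
Proof.
by rewrite /cell /= !in_itv/= !intrD !mulrDr !mulr1.
Qed.

Lemma open_cell_sub h k : open_cell h k `<=` cell h k.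
Proof. by move=> z /open_cellP ?; apply/cellP; lra. Qed.

Lemma measurable_cell h k : measurable (cell h k : set PB).
Proof. by apply: measurableX. Qed.

Lemma measurable_open_cell h k : measurable (open_cell h k : set PB).
Proof. by apply: measurableX. Qed.

Lemma area_cell h k : 0 < h -> area (cell h k) = (h ^+ 2)%:E.
Proof.
move=> h0; rewrite area_box !lebesgue_measure_itv/= !lte_fin !ltr_pM2l//.
rewrite !ltr_int !ltrDl/= -!EFinD -EFinM; congr EFin.
by rewrite !intrD; ring.
Qed.

Lemma area_open_cell h k : 0 < h -> area (open_cell h k) = (h ^+ 2)%:E.
Proof.
move=> h0; rewrite area_box !lebesgue_measure_itv/= !lte_fin !ltr_pM2l//.
rewrite !ltr_int !ltrDl/= -!EFinD -EFinM; congr EFin.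
by rewrite !intrD; ring.
Qed.

Lemma area_cellI h k A : 0 < h -> measurable (A : set PB) ->
  area (cell h k `&` A) = area (open_cell h k `&` A).
Proof.
move=> h0 mA; have mc := measurable_cell h k; have mo := measurable_open_cell h k.
have z0 : area (cell h k `\` open_cell h k) = 0%E.
  have fc : (area (cell h k) < +oo)%E by rewrite area_cell// ltry.
  apply: (eq_trans (measureD mc mo fc)); rewrite (setIidr (@open_cell_sub h k)).
  transitivity ((h ^+ 2)%:E - (h ^+ 2)%:E)%E; last by rewrite subee.
  by congr (_ - _)%E; [exact: area_cell|exact: area_open_cell].
have -> : cell h k `&` A = (open_cell h k `&` A) `|` ((cell h k `\` open_cell h k) `&` A).
  apply/seteqP; split=> z.
    by move=> [cz Az]; have [oz|oz] := pselect (open_cell h k z); [left|right].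
  by move=> [[/open_cell_sub oz Az]|[[cz _] Az]].
rewrite measureU//.
- rewrite [X in (_ + X)%E](_ : _ = 0%E) ?adde0//.
  apply/eqP; rewrite eq_le measure_ge0 andbT -z0 le_measure ?inE//.
  + by apply: measurableI => //; exact: measurableD.
  + exact: measurableD.
- exact: measurableI.
- by apply: measurableI => //; exact: measurableD.
- by apply/seteqP; split => z // [[oz _] [[_ noz] _]].
Qed.

Lemma area_massE h k A : 0 < h -> measurable (A : set PB) ->
  area (open_cell h k `&` A) = (mass h k A)%:E.
Proof.
move=> h0 mA; rewrite /mass fineK//.
rewrite ge0_fin_numE//; apply: (@le_lt_trans _ _ (area (open_cell h k))).
  by rewrite le_measure ?inE//; [apply: measurableI => //|]; exact: measurable_open_cell.
by rewrite area_open_cell// ltry.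
Qed.

Lemma mass_ge0 h k A : 0 <= mass h k A.
Proof. exact: fine_ge0. Qed.

Lemma mass_le h k A B : 0 < h -> measurable (A : set PB) -> measurable (B : set PB) ->
  open_cell h k `&` A `<=` B -> mass h k A <= mass h k B.
Proof.
move=> h0 mA mB AB; rewrite -lee_fin -!area_massE// le_measure ?inE//.
- by apply: measurableI => //; exact: measurable_open_cell.
- by apply: measurableI => //; exact: measurable_open_cell.
- by move=> z [oz Az]; split => //; exact: AB.
Qed.

Lemma mass_empty h k A : open_cell h k `&` A `<=` set0 -> mass h k A = 0.
Proof. by rewrite subset0 /mass => ->; rewrite measure0. Qed.

Lemma mass_full h k A : 0 < h -> open_cell h k `<=` A -> mass h k A = h ^+ 2.
Proof. by move=> h0 /setIidl; rewrite /mass => ->; rewrite [X in fine X]area_open_cell. Qed.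

Lemma mass_le_full h k A : 0 < h -> measurable (A : set PB) -> mass h k A <= h ^+ 2.
Proof.
move=> h0 mA; rewrite -(mass_full h k _ h0 (@subsetT _ _)); exact: mass_le.
Qed.

Lemma mass_split h k A B : 0 < h -> measurable (A : set PB) -> measurable (B : set PB) ->
  mass h k A = mass h k (A `&` B) + mass h k (A `\` B).
Proof.
move=> h0 mA mB; apply: EFin_inj; rewrite EFinD -!area_massE//; last first.
- exact: measurableI.
- exact: measurableD.
have mo := measurable_open_cell h k.
rewrite -measureU.
- congr (area _); rewrite -setIUr; congr setI.
  by rewrite setUIDK.
- by apply: measurableI => //; exact: measurableI.
- by apply: measurableI => //; exact: measurableD.
- by apply/seteqP; split => z // [[_ [_ Bz]] [_ []]].
Qed.

Lemma mass_leU h k A B C : 0 < h -> measurable (A : set PB) -> measurable (B : set PB) ->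
  measurable (C : set PB) ->
  open_cell h k `&` A `<=` B `|` C -> mass h k A <= mass h k B + mass h k C.
Proof.
move=> h0 mA mB mC ABC; rewrite (mass_split h k A B h0 mA mB); apply: lerD.
  by apply: mass_le => //; [exact: measurableI|move=> z [_ []]].
apply: mass_le => //; first exact: measurableD.
by move=> z [oz [Az nBz]]; have [] := ABC z.
Qed.

Lemma average_indic h k A : 0 < h -> measurable (A : set PB) ->
  average (cell h k) \1_A = mass h k A / h ^+ 2.
Proof.
move=> h0 mA; rewrite /average [X in fine X]area_cell//= mulrC; congr (_ / _).
rewrite /Rintegral.
have -> : (\int[area]_(x in cell h k) (\1_A x)%:E)%E = area (A `&` cell h k).
  by rewrite integral_indic//; exact: measurable_cell.
by rewrite setIC area_cellI.
Qed.

(** A set stable under a translation loses no area when it is moved along with the cell. *)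
Lemma mass_translate_cover h k d W (ks : seq (int * int)) : 0 < h ->
  measurable (W : set PB) -> (forall z, W z -> W (d + z)) ->
  (forall z, open_cell h k z -> exists2 k', k' \in ks & cell h k' (d + z)) ->
  mass h k W <= \sum_(k' <- ks) mass h k' W.
Proof.
move=> h0 mW Wd cov.
pose U := \big[setU/set0]_(k' <- ks) (cell h k' `&` W).
have mU : measurable (U : set PB).
  by apply: bigsetU_measurable => k' _; apply: measurableI => //; exact: measurable_cell.
rewrite -lee_fin -area_massE//.
apply: (@le_trans _ _ (area U)).
  rewrite -(area_translate d U mU) le_measure ?inE//.
  - by apply: measurableI => //; exact: measurable_open_cell.
  - have -> : [set z | U (d + z)] = (fun z => (d.1 + z.1, d.2 + z.2)) @^-1` U by [].
    rewrite -[X in measurable X]setTI.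
    exact: (measurable_translate d).
  - move=> z [oz Wz] /=; rewrite /U -bigcup_seq.
    by have [k' kk ck] := cov z oz; exists k' => //; split => //; exact: Wd.
rewrite /U -sumEFin.
elim: ks {cov U mU} => [|k' ks IH]; first by rewrite !big_nil measure0.
rewrite !big_cons; apply: (le_trans (measureU2 _ _ _)) => /=.
- by apply: measurableI => //; exact: measurable_cell.
- by apply: bigsetU_measurable => j _; apply: measurableI => //; exact: measurable_cell.
- by apply: leeD => //; rewrite area_cellI// area_massE.
Qed.

End CellMass.

(** * Stability of half-planes under stencil averages *)

Section Stability.
Context {R : realType}.
Implicit Types (A B W H : set (R * R)) (z w n d e : R * R) (h c E : R) (k : int * int).
Local Notation RB := (measurableTypeR R).
Local Notation PB := (RB * RB)%type.

Definition stencil_close h k A B E : Prop :=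
  forall a b : int, -1 <= a <= 1 -> -1 <= b <= 1 ->
    `|mass h (k.1 + a, k.2 + b) A - mass h (k.1 + a, k.2 + b) B| <= E.

Lemma stencil_close_sym h k A B E : stencil_close h k A B E -> stencil_close h k B A E.
Proof. by move=> AB a b ha hb; rewrite distrC; exact: AB. Qed.

(** With [B] inside [A] in the cell, the area of [A `\` B] is the difference of the two areas. *)
Lemma mass_setD_le h k A B E : 0 < h -> measurable (A : set PB) ->
  measurable (B : set PB) -> open_cell h k `&` (B `\` A) `<=` set0 ->
  `|mass h k A - mass h k B| <= E -> mass h k (A `\` B) <= E.
Proof.
move=> h0 mA mB BA; rewrite (mass_split h k A B)// (mass_split h k B A)//.
rewrite (setIC B) (mass_empty _ _ _ BA) addr0 addrAC subrr add0r.
exact: le_trans (ler_norm _).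
Qed.

Lemma in_half_plane n c H z : half_plane n c H -> H z -> dot n z <= c.
Proof. by case=> _ [] -> /=; lra. Qed.

Lemma notin_half_plane n c H z : half_plane n c H -> ~ H z -> c <= dot n z.
Proof. by case=> _ [] -> /= /negP; rewrite -?ltNge -?leNgt; lra. Qed.

Lemma half_plane_mem n c H z : half_plane n c H -> dot n z < c -> H z.
Proof. by case=> _ [] -> /=; lra. Qed.

Lemma half_plane_notin n c H z : half_plane n c H -> c < dot n z -> ~ H z.
Proof. by case=> _ [] -> /=; lra. Qed.

Lemma half_plane_le n c H z w : half_plane n c H -> dot n z <= dot n w -> H w -> H z.
Proof. by case=> _ [] -> /=; lra. Qed.

Lemma dotDr n z w : dot n (z + w) = dot n z + dot n w.
Proof. by rewrite /dot/=; ring. Qed.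

Lemma dotBr n z w : dot n (z - w) = dot n z - dot n w.
Proof. by rewrite /dot/=; ring. Qed.

Lemma dotZr n a z : dot n (a *: z) = a * dot n z.
Proof. by rewrite /dot/= /GRing.scale/=; ring. Qed.

Lemma shift_le_one h (k : int) (t x : R) : - h <= t <= h ->
  h * k%:~R < x < h * k%:~R + h -> exists2 j : int, j \in [:: -1; 0; 1] &
    h * (k + j)%:~R <= t + x <= h * (k + j)%:~R + h.
Proof.
move=> th xk; have [t1|t1] := leP (t + x) (h * k%:~R).
  by exists (-1) => //; rewrite intrD; lra.
have [t2|t2] := leP (t + x) (h * k%:~R + h); first by exists 0 => //; rewrite addr0; lra.
by exists 1 => //; rewrite intrD; lra.
Qed.

Lemma shift_one h (k s : int) (x : R) : h * k%:~R < x < h * k%:~R + h ->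
  h * (k + s)%:~R <= h * s%:~R + x <= h * (k + s)%:~R + h.
Proof. by rewrite intrD; lra. Qed.

(** If H1 \ H2 meets the cell at [w], then no point of H2 \ H1 lies in the open cells
    next to it on the side of [e], since [e] is larger there than at [w].  In these
    three cells H1 \ H2 therefore has area at most [E], and the translation by
    [h *: d] moves the part of H1 \ H2 in the cell into them. *)
Lemma mass_setD_escape h k n1 c1 H1 n2 c2 H2 e d E : 0 < h ->
  half_plane n1 c1 H1 -> half_plane n2 c2 H2 ->
  axis_unit e -> escape_direction n1 n2 e d -> stencil_close h k H1 H2 E ->
  mass h k (H1 `\` H2) <= E *+ 3.
Proof.
move=> h0 hp1 hp2 ae [d1 d2 ed /andP[n1d n2d] sep] near.
have mH1 := measurable_half_plane _ _ _ hp1; have mH2 := measurable_half_plane _ _ _ hp2.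
have E0 : 0 <= E by apply: le_trans (near 0 0 _ _).
have [[w [ow [H1w nH2w]]]|noW] := pselect (exists w, open_cell h k w /\ (H1 `\` H2) w);
  last first.
  rewrite mass_empty ?mulrn_wge0// => w [ow Ww]; apply: noW; by exists w.
have stepW z : (H1 `\` H2) z -> (H1 `\` H2) (h *: d + z).
  move=> [H1z nH2z]; split.
    by apply: half_plane_le _ _ _ _ _ hp1 _ H1z; rewrite dotDr dotZr; nra.
  by apply: contra_not nH2z; apply: half_plane_le _ _ _ _ _ hp2 _; rewrite dotDr dotZr; nra.
have sepW z : (H2 `\` H1) z -> dot e z <= dot e w.
  move=> [H2z nH1z]; rewrite -subr_ge0 -dotBr; apply: sep; rewrite dotBr.
    by have := in_half_plane _ _ _ _ hp1 H1w; have := notin_half_plane _ _ _ _ hp1 nH1z; lra.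
  by have := in_half_plane _ _ _ _ hp2 H2z; have := notin_half_plane _ _ _ _ hp2 nH2w; lra.
have mW : measurable (H1 `\` H2 : set PB) by exact: measurableD.
have single (a b : int) : -1 <= a <= 1 -> -1 <= b <= 1 -> dot e (a%:~R, b%:~R) = 1 ->
    mass h (k.1 + a, k.2 + b) (H1 `\` H2) <= E.
  move=> ha hb eab; apply: mass_setD_le => //; last exact: near.
  move=> z [/open_cellP/= oz /sepW]; move: ow => /open_cellP/=; move: oz eab.
  rewrite !intrD; case: ae => s [] -> [] -> /=; rewrite /dot/= ?rmorphN/=; nra.
case: ae => s hs he.
have ss : s%:~R * s%:~R = 1 :> R by case: hs => ->; rewrite -intrM.
have s1 : -1 <= s <= 1 by case: hs => ->.
have sum3 (x y t : int * int) : mass h x (H1 `\` H2) <= E ->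
    mass h y (H1 `\` H2) <= E -> mass h t (H1 `\` H2) <= E ->
    \sum_(k' <- [:: x; y; t]) mass h k' (H1 `\` H2) <= E *+ 3.
  move=> mx my mt; rewrite !big_cons big_nil !mulrS mulr0n.
  exact: lerD mx (lerD my (lerD mt (lexx 0))).
have bd (x : R) : `|x| <= 1 -> - h <= h * x <= h.
  by move=> x1; rewrite -ler_norml normrM (gtr0_norm h0) ger_pMr.
(* Along e the translation is by exactly one cell; across e it is by at most one,
   hence into one of three consecutive cells. *)
case: he => he; rewrite he /dot/= in ed single.
- rewrite mul0r addr0 in ed.
  have ed1 : d.1 = s%:~R by rewrite -[LHS]mul1r -[X in X * _ = _]ss -mulrA ed mulr1.
  apply: (le_trans (mass_translate_cover h k (h *: d) _
    [seq (k.1 + s, k.2 + j) | j <- [:: -1; 0; 1]] h0 mW stepW _)).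
    move=> z /open_cellP[oz1 oz2].
    have [j j3 hj] := shift_le_one _ _ _ _ (bd _ d2) oz2.
    exists (k.1 + s, k.2 + j); first exact: map_f.
    by apply/cellP; split=> //; rewrite /= ed1; exact: shift_one.
  by apply: sum3; apply: single => //=; rewrite mul0r addr0.
- rewrite mul0r add0r in ed.
  have ed2 : d.2 = s%:~R by rewrite -[LHS]mul1r -[X in X * _ = _]ss -mulrA ed mulr1.
  apply: (le_trans (mass_translate_cover h k (h *: d) _
    [seq (k.1 + j, k.2 + s) | j <- [:: -1; 0; 1]] h0 mW stepW _)).
    move=> z /open_cellP[oz1 oz2].
    have [j j3 hj] := shift_le_one _ _ _ _ (bd _ d1) oz1.
    exists (k.1 + j, k.2 + s); first exact: map_f.
    by apply/cellP; split=> //; rewrite /= ed2; exact: shift_one.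
  by apply: sum3; apply: single => //=; rewrite mul0r add0r.
Qed.

(** The corner cell towards which -n1 and n2 both point lies strictly inside H1
    and outside H2, because both boundary lines pass through the central cell. *)
Lemma opposite_corner h k n1 c1 H1 n2 c2 H2 E : 0 < h ->
  half_plane n1 c1 H1 -> half_plane n2 c2 H2 ->
  [set z | dot n1 z = c1] `&` cell h k !=set0 ->
  [set z | dot n2 z = c2] `&` cell h k !=set0 ->
  n1.1 * n2.1 <= 0 -> n1.2 * n2.2 <= 0 ->
  stencil_close h k H1 H2 E -> h ^+ 2 <= E.
Proof.
move=> h0 hp1 hp2 [p1 [/= E1 /cellP cp1]] [p2 [/= E2 /cellP cp2]] n11 n22 near.
have sgn (x y : R) : x * y <= 0 -> exists2 s : int, s = 1 \/ s = -1 &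
    x * s%:~R <= 0 /\ 0 <= y * s%:~R.
  move=> xy; have [x0|x0|x0] := ltgtP x 0.
  - by exists 1; [left|rewrite /=; nra].
  - by exists (-1); [right|rewrite /=; nra].
  - have [y0|y0] := leP 0 y; first by exists 1; [left|rewrite /=; nra].
    by exists (-1); [right|rewrite /=; nra].
(* (s, t) is the offset of the corner cell. *)
have [s hs [n1s n2s]] := sgn _ _ n11.
have [t ht [n1t n2t]] := sgn _ _ n22.
have s1 : -1 <= s <= 1 by case: hs => ->.
have t1 : -1 <= t <= 1 by case: ht => ->.
have tz : t%:~R * t%:~R = 1 :> R by case: ht => ->; rewrite -intrM.
have sz : s%:~R * s%:~R = 1 :> R by case: hs => ->; rewrite -intrM.
have side p z : cell h k p -> open_cell h (k.1 + s, k.2 + t) z ->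
    0 < s%:~R * (z.1 - p.1) /\ 0 < t%:~R * (z.2 - p.2).
  move=> /cellP + /open_cellP; rewrite /= !intrD.
  by case: hs => ->; case: ht => -> /=; lra.
have nz n c H : half_plane n c H -> n.1 != 0 \/ n.2 != 0.
  case=> n0 _; have [n10|] := eqVneq n.1 0; last by left.
  right; apply: contra_neq n0 => n20.
  by rewrite [LHS]surjective_pairing n10 n20.
have in1 : open_cell h (k.1 + s, k.2 + t) `<=` H1.
  move=> z oz; apply: (half_plane_mem _ _ _ _ hp1).
  have [|z1 z2] := side p1 z _ oz; first exact/cellP.
  rewrite -E1 -subr_lt0 -dotBr /dot/=.
  have -> : n1.1 * (z.1 - p1.1) + n1.2 * (z.2 - p1.2) =
    (n1.1 * s%:~R) * (s%:~R * (z.1 - p1.1)) + (n1.2 * t%:~R) * (t%:~R * (z.2 - p1.2)).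
    by rewrite -!mulrA !(mulrA s%:~R) !(mulrA t%:~R) sz tz; ring.
  have [N0|N0] := nz _ _ _ hp1.
    have : n1.1 * s%:~R < 0 by rewrite lt_neqAle n1s mulf_neq0//; case: hs => ->.
    by nra.
  have : n1.2 * t%:~R < 0 by rewrite lt_neqAle n1t mulf_neq0//; case: ht => ->.
  by nra.
have out2 : open_cell h (k.1 + s, k.2 + t) `&` H2 `<=` set0.
  move=> z [oz]; apply: (half_plane_notin _ _ _ _ hp2).
  have [|z1 z2] := side p2 z _ oz; first exact/cellP.
  rewrite -E2 -subr_gt0 -dotBr /dot/=.
  have -> : n2.1 * (z.1 - p2.1) + n2.2 * (z.2 - p2.2) =
    (n2.1 * s%:~R) * (s%:~R * (z.1 - p2.1)) + (n2.2 * t%:~R) * (t%:~R * (z.2 - p2.2)).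
    by rewrite -!mulrA !(mulrA s%:~R) !(mulrA t%:~R) sz tz; ring.
  have [N0|N0] := nz _ _ _ hp2.
    have : 0 < n2.1 * s%:~R by rewrite lt_neqAle n2s eq_sym mulf_neq0//; case: hs => ->.
    by nra.
  have : 0 < n2.2 * t%:~R by rewrite lt_neqAle n2t eq_sym mulf_neq0//; case: ht => ->.
  by nra.
have := near s t s1 t1.
rewrite (mass_full _ _ _ h0 in1) (mass_empty _ _ _ out2) subr0.
by apply: le_trans; exact: ler_norm.
Qed.

Lemma half_plane_stability h k n1 c1 H1 n2 c2 H2 E : 0 < h ->
  half_plane n1 c1 H1 -> half_plane n2 c2 H2 ->
  [set z | dot n1 z = c1] `&` cell h k !=set0 ->
  [set z | dot n2 z = c2] `&` cell h k !=set0 ->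
  stencil_close h k H1 H2 E ->
  mass h k (H1 `\` H2) + mass h k (H2 `\` H1) <= E *+ 6.
Proof.
move=> h0 hp1 hp2 T1 T2 near.
have mH1 := measurable_half_plane _ _ _ hp1; have mH2 := measurable_half_plane _ _ _ hp2.
have E0 : 0 <= E by apply: le_trans (near 0 0 _ _).
have near0 : `|mass h k H1 - mass h k H2| <= E.
  by have := near 0 0; rewrite !addr0 -surjective_pairing; apply.
case: (normals_trichotomy n1 n2) => [[n11 n22]|[l l0 nl]|[e ae [d de]]].
- have hE := opposite_corner _ _ _ _ _ _ _ _ _ h0 hp1 hp2 T1 T2 n11 n22 near.
  have m1 : mass h k (H1 `\` H2) <= h ^+ 2 by apply: mass_le_full => //; exact: measurableD.
  have m2 : mass h k (H2 `\` H1) <= h ^+ 2 by apply: mass_le_full => //; exact: measurableD.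
  apply: le_trans (lerD (le_trans m1 hE) (le_trans m2 hE)) _.
  by rewrite -mulr2n (_ : 6 = 2 + 4)%N// mulrnDr lerDl mulrn_wge0.
(* Points of both differences would lie on the same level line of dot n1, and
   membership in H1 depends on the level only. *)
- have nested : (H1 `\` H2 = set0) \/ (H2 `\` H1 = set0).
    have [[w [H1w nH2w]]|] := pselect ((H1 `\` H2) !=set0); last first.
      by move=> N; left; apply/seteqP; split => // z Wz; apply: N; exists z.
    right; apply/seteqP; split => // z [H2z nH1z]; apply: nH1z.
    apply: half_plane_le hp1 _ H1w.
    have := in_half_plane _ _ _ _ hp2 H2z; have := notin_half_plane _ _ _ _ hp2 nH2w.
    by rewrite nl /dot/= /GRing.scale/=; nra.
  rewrite (_ : E *+ 6 = 6 * E); last by rewrite mulr_natl.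
  case: nested => N.
    have : mass h k (H2 `\` H1) <= E.
      by apply: (mass_setD_le _ _ _ _ _ h0 mH2 mH1); [rewrite N setI0|rewrite distrC].
    by rewrite N [mass h k set0]mass_empty ?setI0//; lra.
  have : mass h k (H1 `\` H2) <= E.
    by apply: mass_setD_le => //; rewrite N setI0.
  by rewrite N [mass h k set0]mass_empty ?setI0//; lra.
- rewrite (_ : 6 = 3 + 3)%N// mulrnDr; apply: lerD.
    exact: (mass_setD_escape _ _ _ _ _ _ _ _ _ _ _ h0 hp1 hp2 ae de near).
  exact: (mass_setD_escape _ _ _ _ _ _ _ _ _ _ _ h0 hp2 hp1 (axis_unitN _ ae)
    (escape_direction_sym _ _ _ _ de) (stencil_close_sym _ _ _ _ _ near)).
Qed.

End Stability.

(** * Error of the least-squares fit in one cell *)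

Section LocalFit.
Context {R : realType}.
Implicit Types (A B W H : set (R * R)) (z w n d e : R * R) (h c E M : R) (k : int * int).
Local Notation RB := (measurableTypeR R).
Local Notation PB := (RB * RB)%type.
Local Notation lam := (@lebesgue_measure R).

Definition strip n c (del : R) : set (R * R) := [set z | `|dot n z - c| <= del].

Lemma measurable_strip n c del : measurable (strip n c del : set PB).
Proof.
have := measurable_dot n measurableT `[c - del, c + del]%classic (measurable_itv _).
rewrite setTI; congr (measurable _); apply/seteqP; split => z /=.
  by rewrite /strip/= in_itv/= ler_norml; lra.
by rewrite /strip/= in_itv/= ler_norml; lra.
Qed.

Lemma lebesgue_slab (a b c del : R) (A : set R) : 0 <= del -> 1 / 2 <= b ^+ 2 ->
  (forall y, A y -> `|a + b * y - c| <= del) -> measurable (A : set RB) ->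
  (lam A <= (4 * del)%:E)%E.
Proof.
move=> del0 b2 Aab mA; have b0 : b != 0 by apply: contraTneq b2 => ->; rewrite expr0n/=; lra.
pose y0 := (c - a) / b.
apply: (@le_trans _ _ (lam `[y0 - 2 * del, y0 + 2 * del]%classic)); last first.
  rewrite lebesgue_measure_itv/= lte_fin; case: ifP => _; last by rewrite lee_fin; lra.
  by rewrite -EFinD lee_fin; lra.
rewrite le_measure ?inE// => y /Aab yb /=; rewrite in_itv/=.
have e1 : a + b * y - c = b * (y - y0) by rewrite /y0; field.
move: yb; rewrite e1 normrM => yb.
have nb : 1 / 2 <= `|b|.
  rewrite -(@ler_pXn2r _ 2)// ?nnegrE// ?real_normK ?num_real//; lra.
have : `|y - y0| <= 2 * del by have := normr_ge0 (y - y0); nra.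
by rewrite ler_norml; lra.
Qed.

(** One coordinate of [n] has a square at least 1/2; along this axis the strip has
    sections of length at most 4 del. *)
Lemma mass_strip h k n c del : 0 < h -> 0 <= del -> 1 <= dot n n ->
  mass h k (strip n c del) <= 4 * h * del.
Proof.
move=> h0 del0 nn; have ms := measurable_strip n c del.
have mA : measurable (cell h k `&` strip n c del : set PB).
  by apply: measurableI => //; exact: measurable_cell.
rewrite -lee_fin -area_massE// -area_cellI//.
have [n2|n2] := leP (1 / 2) (n.2 ^+ 2).
  rewrite (_ : 4 * h * del = 4 * del * (h * k.1%:~R + h - h * k.1%:~R)); last by ring.
  apply: area_le_xsection => //; [|lra|lra|].
    by move=> z [/cellP[z1 z2] _].
  move=> x; apply: (lebesgue_slab (n.1 * x) n.2 c) => //.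
    by move=> y; rewrite /xsection/= inE => -[_]; rewrite /strip/= /dot/=.
  exact: measurable_xsection.
have n1 : 1 / 2 <= n.1 ^+ 2 by move: nn; rewrite /dot; rewrite -!expr2; lra.
rewrite (_ : 4 * h * del = 4 * del * (h * k.2%:~R + h - h * k.2%:~R)); last by ring.
apply: area_le_ysection => //; [|lra|lra|].
  by move=> z [/cellP[z1 z2] _].
move=> y; apply: (lebesgue_slab (n.2 * y) n.1 c) => //.
  by move=> x; rewrite /ysection/= inE => -[_]; rewrite /strip/= /dot/= (addrC (n.1 * x)).
exact: measurable_ysection.
Qed.

Definition symdiff_mass h k A B : R := mass h k (A `\` B) + mass h k (B `\` A).

Lemma symdiff_mass_triangle h k A B W : 0 < h -> measurable (A : set PB) ->
  measurable (B : set PB) -> measurable (W : set PB) ->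
  symdiff_mass h k A W <= symdiff_mass h k A B + symdiff_mass h k B W.
Proof.
move=> h0 mA mB mW; rewrite /symdiff_mass.
have s1 : mass h k (A `\` W) <= mass h k (A `\` B) + mass h k (B `\` W).
  apply: mass_leU => //; try exact: measurableD.
  by move=> z [_ [Az nW]]; have [Bz|Bz] := pselect (B z); [right|left].
have s2 : mass h k (W `\` A) <= mass h k (B `\` A) + mass h k (W `\` B).
  apply: mass_leU => //; try exact: measurableD.
  by move=> z [_ [Az nW]]; have [Bz|Bz] := pselect (B z); [left|right].
by rewrite addrACA; exact: lerD.
Qed.

Lemma mass_sub_le h k A B : 0 < h -> measurable (A : set PB) ->
  measurable (B : set PB) -> `|mass h k A - mass h k B| <= symdiff_mass h k A B.
Proof.
move=> h0 mA mB; rewrite /symdiff_mass (mass_split h k A B)// (mass_split h k B A)//.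
rewrite (setIC B).
rewrite [X in `|X|](_ : _ = mass h k (A `\` B) - mass h k (B `\` A)); last first.
  by rewrite opprD addrACA subrr add0r.
apply: le_trans (ler_normB _ _) _.
by rewrite !ger0_norm ?mass_ge0.
Qed.

Lemma le_l2norm (A : 'M[R]_3) i j : `|A i j| <= l2norm A.
Proof.
rewrite -sqrtr_sqr /l2norm; apply: ler_wsqrtr.
rewrite (bigD1 i)//= (bigD1 j)//= -addrA lerDl addr_ge0//.
  by apply: sumr_ge0 => *; rewrite sqr_ge0.
by apply: sumr_ge0 => *; apply: sumr_ge0 => *; rewrite sqr_ge0.
Qed.

Lemma l2norm_le (A : 'M[R]_3) M : (forall i j, `|A i j| <= M) -> l2norm A <= 3 * M.
Proof.
move=> AM; have M0 : 0 <= M by apply: le_trans (AM ord0 ord0).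
rewrite /l2norm -[leRHS]ger0_norm; last by lra.
rewrite -sqrtr_sqr; apply: ler_wsqrtr.
apply: (@le_trans _ _ (\sum_(i < 3) \sum_(j < 3) M ^+ 2)).
  apply: ler_sum => i _; apply: ler_sum => j _.
  by rewrite -real_normK ?num_real// lerXn2r ?nnegrE.
by rewrite !sumr_const !card_ord -mulrnA exprMn -natrX mulr_natl.
Qed.

Lemma stencil_averagesE h k A i j : 0 < h -> measurable (A : set PB) ->
  stencil_averages h k (\1_A) i j =
  mass h (k.1 + (i%:Z - 1), k.2 + (j%:Z - 1)) A / h ^+ 2.
Proof.
move=> h0 mA; rewrite mxE.
apply: (eq_trans (average_indic _ _ _ h0 mA)).
by rewrite /= !addrA.
Qed.

(** [H0] bounds the minimum of the least-squares functional, so the best fit is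
    close to [Omega], hence to [H0], in all nine averages; stability then bounds
    its distance to [H0] in the central cell. *)
Lemma lvira_error h k (Omega H0 : set (R * R)) n c M v : 0 < h ->
  measurable (Omega : set PB) -> half_plane n c H0 ->
  [set z | dot n z = c] `&` cell h k !=set0 ->
  (forall a b : int, -1 <= a <= 1 -> -1 <= b <= 1 ->
     symdiff_mass h (k.1 + a, k.2 + b) Omega H0 <= M) ->
  argmin (linear_interfaces (cell h k))
    (fun f => l2norm (stencil_averages h k f - stencil_averages h k \1_Omega)) v ->
  exists2 H, measurable (H : set PB) & v = \1_H /\ symdiff_mass h k Omega H <= 25 * M.
Proof.
move=> h0 mO hp0 T0 OM [[n' [c' [H [hp T ->]]]] vmin].
have mH := measurable_half_plane _ _ _ hp; have mH0 := measurable_half_plane _ _ _ hp0.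
exists H => //; split => //.
have near1 a b (ha : -1 <= a <= 1) (hb : -1 <= b <= 1) :
    `|mass h (k.1 + a, k.2 + b) H0 - mass h (k.1 + a, k.2 + b) Omega| <= M.
  by rewrite distrC; apply: le_trans (mass_sub_le _ _ _ _ h0 mO mH0) (OM a b ha hb).
have rng (i : 'I_3) : -1 <= i%:Z - 1 <= 1 by case: i => -[|[|[|]]].
have h2 : 0 < h ^+ 2 by rewrite exprn_gt0.
have h2V : 0 < (h ^+ 2)^-1 by rewrite invr_gt0.
have fit : l2norm (stencil_averages h k \1_H - stencil_averages h k \1_Omega) <= 3 * (M / h ^+ 2).
  apply: le_trans (vmin \1_H0 _) _; first by exists n, c, H0.
  apply: l2norm_le => i j; rewrite mxE [X in _ + X]mxE !stencil_averagesE//.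
  rewrite -mulrBl normrM (gtr0_norm h2V); apply: ler_wpM2r; first exact: ltW.
  exact: near1.
(* 3 M from Omega to the fit and M from Omega to H0. *)
have near2 : stencil_close h k H H0 (4 * M).
  move=> a b ha hb.
  have [i ai] : exists i : 'I_3, i%:Z - 1 = a.
    by exists (inord (absz (a + 1))); rewrite inordK; lia.
  have [j bj] : exists j : 'I_3, j%:Z - 1 = b.
    by exists (inord (absz (b + 1))); rewrite inordK; lia.
  have := le_trans (le_l2norm _ i j) fit.
  rewrite mxE [X in _ + X]mxE !stencil_averagesE// ai bj -mulrBl normrM.
  rewrite (gtr0_norm h2V) ler_pdivrMr// => near3.
  apply: le_trans (ler_distD (mass h (k.1 + a, k.2 + b) Omega) _ _) _.
  rewrite (_ : 4 * M = 3 * (M / h ^+ 2) * h ^+ 2 + M); last by field; rewrite gt_eqF.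
  by apply: lerD => //; rewrite distrC; exact: near1.
have := half_plane_stability _ _ _ _ _ _ _ _ _ h0 hp0 hp T0 T (stencil_close_sym _ _ _ _ _ near2).
rewrite -/(symdiff_mass h k H0 H) => st.
apply: le_trans (symdiff_mass_triangle h k _ H0 _ h0 mO mH0 mH) _.
have OM0 : symdiff_mass h k Omega H0 <= M.
  by have := OM 0 0 isT isT; rewrite !addr0 -surjective_pairing.
(* M + 6 (4 M) = 25 M *)
apply: le_trans (lerD OM0 st) _.
by rewrite le_eqVlt; apply/orP; left; apply/eqP; ring.
Qed.

End LocalFit.

(** * Lipschitz and Taylor estimates for C^s functions *)

Section ChartRegularity.
Context {R : realType}.
Implicit Types (r x y t K s : R) (f g : R -> R) (m k : nat).

Lemma diff_quot_in_eps r f x : cvg (diff_quot_in `[- r, r]%classic f x) ->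
  forall e, 0 < e -> exists2 del, 0 < del & forall t, `|t| <= r -> t != x ->
    `|t - x| < del ->
    `|f t - f x - derive_in `[- r, r]%classic f x * (t - x)| <= e * `|t - x|.
Proof.
move=> /cvgrPdist_lt cf e e0.
have := cf _ e0; rewrite /diff_quot_in -/(diff_quot_in `[- r, r]%classic f x).
rewrite -/(derive_in `[- r, r]%classic f x); set l := derive_in _ _ _.
move=> /nbhs_ballP[/= del del0 H].
exists del => // t tr tx td.
have := H t; rewrite /ball/= distrC => /(_ td tx).
rewrite in_itv/= -ler_norml => /(_ tr) ltx.
have tx0 : t - x != 0 by rewrite subr_eq0.
have -> : f t - f x - l * (t - x) = - (l - (t - x)^-1 * (f t - f x)) * (t - x).
  by field.
by rewrite normrM normrN ler_wpM2r// ltW.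
Qed.

(** At interior points the derivative relative to [-r, r] is the ordinary one, and
    at the endpoints it still yields continuity from inside, so that the classical
    mean value theorem applies. *)
Lemma mvt_in r f x y : x < y -> - r <= x -> y <= r ->
  (forall t, `|t| <= r -> cvg (diff_quot_in `[- r, r]%classic f t)) ->
  exists2 c, x < c < y & f y - f x = derive_in `[- r, r]%classic f c * (y - x).
Proof.
move=> xy rx yr df; set I := `[- r, r]%classic.
have eps t : `|t| <= r -> _ := fun h => diff_quot_in_eps _ _ _ (df t h).
have der c : c \in `]x, y[%R -> is_derive c 1 f (derive_in I f c).
  rewrite in_itv/= => /andP[xc cy].
  have cr : `|c| <= r by rewrite ler_norml; lra.
  have lim1 : (h^-1 *: ((f \o shift c) (h *: (1 : R)) - f c) @[h --> 0^']) --> derive_in I f c.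
    apply/cvgrPdist_le => e e0.
    have [del del0 H] := eps c cr e e0.
    near=> h.
    have h0 : h != 0 by near: h; exact: nbhs_dnbhs_neq.
    have hd : `|h| < Num.min del (Num.min (c - x) (y - c)).
      near: h; apply: dnbhs0_lt; rewrite !lt_min; lra.
    move: hd; rewrite !lt_min => /andP[hd /andP[h1 h2]].
    have hcr : `|h + c| <= r.
      by move: h1 h2; rewrite !ltr_norml ler_norml; lra.
    have := H (h + c) hcr; rewrite -subr_eq0 addrK => /(_ h0 hd).
    move=> H1; rewrite distrC /= /GRing.scale/= mulr1.
    have -> : h^-1 * (f (h + c) - f c) - derive_in I f c =
      h^-1 * (f (h + c) - f c - derive_in I f c * h) by field.
    rewrite normrM normfV mulrC ler_pdivrMr ?normr_gt0//.
  by apply: DeriveDef; [apply/cvg_ex; exists (derive_in I f c)|apply/cvg_lim].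
have cont c e : `|c| <= r -> 0 < e -> exists2 del, 0 < del &
    forall t, `|t| <= r -> `|t - c| < del -> `|f c - f t| <= e.
  move=> cr e0; have [del del0 H] := eps c cr 1 ltr01.
  set l := derive_in I f c in H.
  exists (Num.min del (e / (1 + `|l|))).
    by rewrite lt_min del0 divr_gt0// ltr_pwDl.
  move=> t tr; rewrite lt_min ltr_pdivlMr ?ltr_pwDl// => /andP[td te].
  have [->|tc] := eqVneq t c; first by rewrite subrr normr0 ltW.
  have := H t tr tc td; rewrite mul1r => H1.
  have -> : f c - f t = - (f t - f c - l * (t - c)) - l * (t - c) by ring.
  apply: le_trans (ler_normB _ _) _; rewrite normrN normrM.
  have := normr_ge0 (t - c); nra.
have [c cxy E] : exists2 c, c \in `]x, y[%R & f y - f x = derive_in I f c * (y - x).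
  apply: MVT => //; apply/continuous_within_itvP => //; split.
  - move=> c cxy; have dc := der c cxy.
    apply: differentiable_continuous; apply/derivable1_diffP; exact: ex_derive.
  - apply/cvgrPdist_le => e e0.
    have [|del del0 H] := cont x e _ e0; first by rewrite ler_norml; lra.
    near=> t; apply: H.
      have : x < t by near: t; exact: nbhs_right_gt.
      have : t < y by near: t; exact: nbhs_right_lt.
      by rewrite ler_norml; lra.
    have : x < t by near: t; exact: nbhs_right_gt.
    have : t < x + del by near: t; apply: nbhs_right_lt; lra.
    by rewrite ltr_norml; lra.
  - apply/cvgrPdist_le => e e0.
    have [|del del0 H] := cont y e _ e0; first by rewrite ler_norml; lra.
    near=> t; apply: H.
      have : x < t by near: t; exact: nbhs_left_gt.
      have : t < y by near: t; exact: nbhs_left_lt.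
      by rewrite ler_norml; lra.
    have : t < y by near: t; exact: nbhs_left_lt.
    have : y - del < t by near: t; apply: nbhs_left_gt; lra.
    by rewrite ltr_norml; lra.
by exists c => //; move: cxy; rewrite in_itv.
Unshelve. all: by end_near. Qed.

Lemma lipschitz_of_derive_in r f K :
  (forall t, `|t| <= r -> cvg (diff_quot_in `[- r, r]%classic f t)) ->
  (forall t, `|t| <= r -> `|derive_in `[- r, r]%classic f t| <= K) ->
  forall x y, `|x| <= r -> `|y| <= r -> `|f x - f y| <= K * `|x - y|.
Proof.
move=> df fK; have main x y : `|x| <= r -> `|y| <= r -> x < y -> `|f x - f y| <= K * `|x - y|.
  rewrite (ler_norml x) (ler_norml y) => xr yr xy; have [||c cxy E] := mvt_in r f x y xy _ _ df; [lra|lra|].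
  rewrite distrC E normrM (distrC x) ler_wpM2r// fK// ler_norml; lra.
move=> x y xr yr; have [xy|xy|->] := ltgtP x y; [exact: main| |].
  by rewrite distrC (distrC x); exact: main.
by rewrite !subrr normr0 mulr0.
Qed.


Lemma adde_lt_pinfty_finite (a b : \bar R) :
  (0 <= a)%E -> (a + b < +oo)%E -> exists K : R, (b <= K%:E)%E.
Proof.
case: b => [b| |] a0 ab; [by exists b| |by exists 0; rewrite leNye].
by move: ab; rewrite addey ?ltxx// gt_eqF// (lt_le_trans _ a0).
Qed.

(** The first supremum in the norm is nonnegative, so that a finite sum bounds the
    second one, which is the Hoelder constant. *)
Lemma is_Cs_holder s r f : 0 < r -> is_Cs s `[- r, r]%classic f ->
  exists2 K, 0 <= K & forall x t, `|x| <= r -> `|t| <= r ->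
    `|derive_in_n `[- r, r]%classic (Cs_order s) f x -
      derive_in_n `[- r, r]%classic (Cs_order s) f t|
      <= K * `|x - t| `^ (s - (Cs_order s)%:R).
Proof.
move=> r0 [_ fin].
have [|K HK] := adde_lt_pinfty_finite _ _ _ fin.
  pose L0 := Lnorm_on lebesgue_measure `[- r, r]%classic +oo%E (derive_in_n `[- r, r]%classic 0 f).
  apply: (@le_trans _ _ L0); first exact: Lnorm_ge0.
  by apply: ereal_sup_ubound; exists 0%N.
exists (Num.max K 0); first by rewrite le_max lexx orbT.
move=> x t xr tr; have [->|xt] := eqVneq x t.
  by rewrite subrr normr0 mulr_ge0 ?powR_ge0// le_max lexx orbT.
set g := derive_in_n _ _ _.
have xt0 : 0 < `|x - t| by rewrite normr_gt0 subr_eq0.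
have : `|x - t| `^ ((Cs_order s)%:R - s) * `|g x - g t| <= K.
  rewrite -lee_fin; apply: le_trans HK; apply: ereal_sup_ubound.
  by exists (x, t) => //; split => //=; rewrite in_itv/= -ler_norml.
rewrite -[(Cs_order s)%:R - s]opprB powRN mulrC ler_pdivrMr ?powR_gt0// => H.
apply: le_trans H _; rewrite ler_wpM2r ?powR_ge0//.
by rewrite le_max lexx.
Qed.

Lemma powR_le_powR (a x M : R) : 0 <= a -> 0 <= x <= M -> x `^ a <= M `^ a.
Proof.
move=> a0 /andP[x0 xM]; apply: ge0_ler_powR => //; rewrite nnegrE//; lra.
Qed.

Lemma Cs_order_bounds s : 1 <= s ->
  (Cs_order s)%:R < s <= (Cs_order s)%:R + 1.
Proof.
move=> s1; rewrite /Cs_order; case: ifPn => [/natrP[n ns]|sN].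
  rewrite ns natrK; case: n ns => [|n] ns; first by move: s1; rewrite ns; lra.
  by rewrite /= -natr1; lra.
have /andP[h1 h2] := truncn_itv (le_trans ler01 s1).
rewrite natr1 (ltW h2) andbT lt_neqAle h1 andbT.
by apply: contraNneq sN => <-; rewrite natr_nat.
Qed.

(** By descending induction on [k]: the derivative of highest order is Hoelder
    continuous, hence bounded on the interval, and a function with a bounded
    derivative is Lipschitz, hence bounded. *)
Lemma is_Cs_derive_bounded s r f : 0 < r -> 1 <= s -> is_Cs s `[- r, r]%classic f ->
  forall k, (k <= Cs_order s)%N -> exists2 K, 0 <= K & forall x, `|x| <= r ->
    `|derive_in_n `[- r, r]%classic k f x| <= K.
Proof.
move=> r0 s1 Cf; have /andP[ms sm] := Cs_order_bounds s s1.
have [K K0 HK] := is_Cs_holder s r f r0 Cf; case: Cf => df _.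
set m := Cs_order s in ms sm HK df *.
move=> k km; rewrite -(subKn km); elim: (m - k)%N => [|j [L L0 HL]].
  rewrite subn0; set g := derive_in_n _ _ _ in HK *.
  exists (`|g 0| + K * (r `^ (s - m%:R))).
    by rewrite addr_ge0// mulr_ge0// powR_ge0.
  move=> x xr; have -> : g x = g 0 + (g x - g 0) by ring.
  apply: le_trans (ler_normD _ _) _; rewrite lerD2l.
  apply: le_trans (HK x 0 xr _) _; first by rewrite normr0 ltW.
  by rewrite ler_wpM2l// subr0 powR_le_powR ?xr ?normr_ge0//; lra.
have [mj|jm] := leqP m j.
  by exists L => //; rewrite (_ : (m - j.+1 = m - j)%N)//; lia.
set g := derive_in_n _ (m - j.+1) f.
have gE : derive_in_n `[- r, r]%classic (m - j) f = derive_in `[- r, r]%classic g.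
  by rewrite (_ : (m - j = (m - j.+1).+1)%N)//; lia.
exists (`|g 0| + L * r); first by rewrite addr_ge0// mulr_ge0// ltW.
move=> x xr; have -> : g x = g 0 + (g x - g 0) by ring.
apply: le_trans (ler_normD _ _) _; rewrite lerD2l.
have r00 : `|0 : R| <= r by rewrite normr0 ltW.
apply: le_trans (lipschitz_of_derive_in r g L _ _ x 0 xr r00) _.
- move=> t tr; apply: df; first by rewrite ltn_subrL (leq_ltn_trans _ jm).
  by rewrite /= in_itv/= -ler_norml.
- by move=> t tr; rewrite -gE; exact: HL.
- by rewrite subr0 ler_wpM2l.
Qed.

Lemma is_Cs_lipschitz s r f : 0 < r -> 1 <= s -> is_Cs s `[- r, r]%classic f ->
  exists2 L, 0 <= L & forall x y, `|x| <= r -> `|y| <= r ->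
    `|f x - f y| <= L * `|x - y|.
Proof.
move=> r0 s1 Cf; have /andP[ms sm] := Cs_order_bounds s s1.
have [m0|m0] := posnP (Cs_order s).
  have s1' : s = 1 by move: sm; rewrite m0; lra.
  have [K K0 HK] := is_Cs_holder s r f r0 Cf; exists K => // x y xr yr.
  by have := HK x y xr yr; rewrite m0 /= s1' subr0 powRr1.
have [K K0 HK] := is_Cs_derive_bounded s r f r0 s1 Cf 1%N m0.
exists K => // x y xr yr; apply: lipschitz_of_derive_in xr yr => //.
move=> t tr; case: Cf => df _; apply: (df 0%N) => //.
by rewrite /= in_itv/= -ler_norml.
Qed.

(** The first derivative is Hoelder continuous of exponent min(s, 2) - 1: by
    definition when it is the last one, and because the second derivative is
    bounded otherwise.  The mean value theorem gains one power of the distance. *)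
Lemma is_Cs_tangent s r f : 0 < r -> 1 < s -> is_Cs s `[- r, r]%classic f ->
  exists2 K, 0 <= K & forall x, `|x| <= r -> exists a, forall y, `|y| <= r ->
    `|f y - f x - a * (y - x)| <= K * `|y - x| `^ Num.min s 2.
Proof.
move=> r0 s1 Cf; have s1' := ltW s1; have /andP[ms sm] := Cs_order_bounds s s1'.
pose g := derive_in `[- r, r]%classic f.
have m0 : (0 < Cs_order s)%N.
  by rewrite lt0n; apply/eqP => m0; move: sm; rewrite m0; lra.
have df t : `|t| <= r -> cvg (diff_quot_in `[- r, r]%classic f t).
  move=> tr; case: Cf => df _; apply: (df 0%N) => //.
  by rewrite /= in_itv/= -ler_norml.
have [K K0 HK] : exists2 K, 0 <= K & forall x y, `|x| <= r -> `|y| <= r ->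
    `|g x - g y| <= K * `|x - y| `^ (Num.min s 2 - 1).
  have [m1|m1] := leqP (Cs_order s) 1.
    have {m0 m1} m1 : Cs_order s = 1%N by lia.
    have [K K0 HK] := is_Cs_holder s r f r0 Cf; exists K => // x y xr yr.
    have -> : Num.min s 2 = s by apply/min_idPl; move: sm; rewrite m1; lra.
    by have := HK x y xr yr; rewrite m1.
  have s2 : 2 < s by apply: le_lt_trans ms; rewrite ler_nat.
  have -> : Num.min s 2 - 1 = 1.
    by rewrite (min_idPr (ltW s2)); lra.
  have [K K0 HK] := is_Cs_derive_bounded s r f r0 s1' Cf 2%N m1.
  exists K => // x y xr yr; rewrite powRr1//.
  apply: lipschitz_of_derive_in xr yr => // t tr.
  case: Cf => df' _; apply: (df' 1%N) => //.
  by rewrite /= in_itv/= -ler_norml.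
exists K => // x xr; exists (g x) => y yr.
have p0 : 0 < Num.min s 2 - 1 by rewrite subr_gt0 lt_min s1 ltr1n.
have fin c : `|c| <= r -> `|c - x| <= `|y - x| ->
    f y - f x = g c * (y - x) ->
    `|f y - f x - g x * (y - x)| <= K * `|y - x| `^ Num.min s 2.
  move=> cr cx ->; rewrite -mulrBl normrM.
  have -> : Num.min s 2 = (Num.min s 2 - 1) + 1 by rewrite subrK.
  have [->|yx] := eqVneq (y - x) 0.
    by rewrite normr0 mulr0 mulr_ge0// powR_ge0.
  rewrite powRD; last by apply/implyP => _; rewrite normr_eq0.
  rewrite powRr1// mulrA ler_wpM2r//.
  apply: le_trans (HK c x cr xr) _; rewrite ler_wpM2l// powR_le_powR ?normr_ge0//.
  exact: ltW.
have [xy|xy|xy] := ltgtP x y.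
- have [||c /andP[xc cy]] := mvt_in r f x y xy _ _ df.
  + by move: xr; rewrite ler_norml; lra.
  + by move: yr; rewrite ler_norml; lra.
  apply: fin; first by move: xr yr; rewrite !ler_norml; lra.
  by rewrite !ger0_norm; lra.
- have [||c /andP[xc cy] E] := mvt_in r f y x xy _ _ df.
  + by move: yr; rewrite ler_norml; lra.
  + by move: xr; rewrite ler_norml; lra.
  apply: (fin c); first by move: xr yr; rewrite !ler_norml; lra.
    by rewrite !ler0_norm; lra.
  by rewrite -[LHS]opprB E -mulrN opprB.
- by rewrite xy !subrr mulr0 subrr normr0 mulr_ge0// powR_ge0.
Qed.

End ChartRegularity.

(** * Charts of the frontier *)

Section Atlas.
Context {R : realType}.
Implicit Types (z w e d : R * R) (Omega : set (R * R)) (r L K s : R) (psi : R -> R).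
Local Notation RB := (measurableTypeR R).
Local Notation PB := (RB * RB)%type.

Definition sup_near (a : R) z w : Prop := `|z.1 - w.1| <= a /\ `|z.2 - w.2| <= a.

Lemma sup_near_le (a b : R) z w : a <= b -> sup_near a z w -> sup_near b z w.
Proof. by move=> ab [h1 h2]; split; [exact: le_trans h1 ab|exact: le_trans h2 ab]. Qed.

Lemma sup_near_trans (a b : R) z w d : sup_near a z w -> sup_near b w d ->
  sup_near (a + b) z d.
Proof.
move=> [z1 z2] [w1 w2]; split.
  exact: le_trans (ler_distD w.1 _ _) (lerD z1 w1).
exact: le_trans (ler_distD w.2 _ _) (lerD z2 w2).
Qed.

Lemma orthonormal_expand e1 e2 z : orthonormal_system e1 e2 ->
  z = dot z e1 *: e1 + dot z e2 *: e2.
Proof.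
case: e1 e2 z => [a b] [c d] [x y]; rewrite /orthonormal_system /dot/= => -[h1 h2 h3].
pose D := a * d - b * c.
have cE : c = - b * D.
  by have := congr1 ( *%R^~ c) h1; have := congr1 ( *%R a) h3; rewrite /D/=; lra.
have dE : d = a * D.
  by have := congr1 ( *%R^~ d) h1; have := congr1 ( *%R b) h3; rewrite /D/=; lra.
have D2 : D * D = 1.
  rewrite -h2 [in RHS]cE [in RHS]dE -[LHS]mulr1 -h1; ring.
have r1 : a * a + c * c = 1.
  by rewrite cE -h1 (_ : _ * _ + _ = a * a + b * b * (D * D)); [rewrite D2 mulr1|ring].
have r2 : b * b + d * d = 1.
  by rewrite dE -h1 (_ : _ * _ + _ = b * b + a * a * (D * D)); [rewrite D2 mulr1 addrC|ring].
have r3 : a * b + c * d = 0.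
  by rewrite cE dE (_ : _ * _ + _ = a * b - a * b * (D * D)); [rewrite D2; ring|ring].
rewrite [RHS]surjective_pairing /= /GRing.scale/=; congr pair.
  transitivity (x * (a * a + c * c) + y * (a * b + c * d)); last by ring.
  by rewrite r1 r3; ring.
transitivity (x * (a * b + c * d) + y * (b * b + d * d)); last by ring.
by rewrite r2 r3; ring.
Qed.

Lemma dot_unit_le e d (a : R) : dot e e = 1 -> `|d.1| <= a -> `|d.2| <= a ->
  `|dot d e| <= 2 * a.
Proof.
rewrite /dot => ee d1 d2; apply: le_trans (ler_normD _ _) _; rewrite !normrM.
have e1 : `|e.1| <= 1.
  by rewrite -(@ler_pXn2r _ 2)// ?nnegrE// real_normK ?num_real// expr1n; nra.
have e2 : `|e.2| <= 1.
  by rewrite -(@ler_pXn2r _ 2)// ?nnegrE// real_normK ?num_real// expr1n; nra.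
have := normr_ge0 d.1; have := normr_ge0 d.2; have := normr_ge0 e.1; have := normr_ge0 e.2.
by nra.
Qed.

(** [L] is a Lipschitz constant of the graph and [K] the constant in the remainder
    of Taylor's formula at order min(s, 2). *)
Definition graph_chart (s : R) Omega r L K z0 e1 e2 psi : Prop :=
  [/\ orthonormal_system e1 e2,
      forall x y : R, `|x| <= r -> `|y| <= r -> `|psi x - psi y| <= L * `|x - y|,
      forall x y : R, `|x| <= r -> `|y| <= r ->
        (Omega (z0 + x *: e1 + y *: e2) <-> y <= psi x) &
      1 < s -> forall x, `|x| <= r -> exists a, forall y, `|y| <= r ->
        `|psi y - psi x - a * (y - x)| <= K * `|y - x| `^ Num.min s 2].

Lemma graph_chart_mono s Omega r L K L' K' z0 e1 e2 psi : L <= L' -> K <= K' ->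
  graph_chart s Omega r L K z0 e1 e2 psi -> graph_chart s Omega r L' K' z0 e1 e2 psi.
Proof.
move=> leL leK [ort lip mem tan]; split => //.
  by move=> x y xr yr; apply: le_trans (lip x y xr yr) _; rewrite ler_wpM2r.
move=> s1 x xr; have [a Ha] := tan s1 x xr; exists a => y yr.
by apply: le_trans (Ha y yr) _; rewrite ler_wpM2r// powR_ge0.
Qed.

Lemma graph_chartP s Omega r L K z0 e1 e2 psi z :
  graph_chart s Omega r L K z0 e1 e2 psi -> sup_near (r / 2) z z0 ->
  [/\ `|dot (z - z0) e1| <= r, `|dot (z - z0) e2| <= r &
    (Omega z <-> dot (z - z0) e2 <= psi (dot (z - z0) e1))].
Proof.
case=> ort lip mem _ [z1 z2]; have [u1 u2 _] := ort.
have d1 : `|dot (z - z0) e1| <= r.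
  by apply: le_trans (dot_unit_le e1 (z - z0) _ u1 z1 z2) _; lra.
have d2 : `|dot (z - z0) e2| <= r.
  by apply: le_trans (dot_unit_le e2 (z - z0) _ u2 z1 z2) _; lra.
split => //; rewrite -(mem _ _ d1 d2).
by rewrite -addrA -(orthonormal_expand _ _ (z - z0) ort) addrC subrK.
Qed.

Lemma nbhs_sup_near z (A : set (R * R)) :
  nbhs z A <-> exists2 a : R, 0 < a & forall w, sup_near a w z -> A w.
Proof.
split=> [/nbhs_ballP[/= a a0 aA]|[a a0 aA]].
  exists (a / 2); first by rewrite divr_gt0.
  move=> w [w1 w2]; apply: aA; split; rewrite /ball/= distrC.
    by apply: le_lt_trans w1 _; lra.
  by apply: le_lt_trans w2 _; lra.
apply/nbhs_ballP; exists a => // w [w1 w2]; apply: aA; split; rewrite distrC; exact: ltW.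
Qed.

Lemma dotBl d w e : dot (d - w) e = dot d e - dot w e.
Proof. by rewrite /dot/=; ring. Qed.

(** A point of the chart strictly below or above the graph has a neighbourhood with
    the same property, by the Lipschitz bound. *)
Lemma frontier_on_graph s Omega r L K z0 e1 e2 psi z : 0 < r -> 0 <= L ->
  graph_chart s Omega r L K z0 e1 e2 psi -> frontier Omega z -> sup_near (r / 8) z z0 ->
  dot (z - z0) e2 = psi (dot (z - z0) e1).
Proof.
move=> r0 L0 C [clz niz] zz; have [[u1 u2 _] lip _ _] := C.
have nz : sup_near (r / 2) z z0 by case: zz => z1 z2; split; lra.
have [x0r y0r _] := graph_chartP _ _ _ _ _ _ _ _ _ z C nz.
set x0 := dot (z - z0) e1 in x0r *; set y0 := dot (z - z0) e2 in y0r *.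
have near (g : R) : 0 < g -> exists2 a : R, 0 < a & forall w, sup_near a w z ->
    [/\ (Omega w <-> dot (w - z0) e2 <= psi (dot (w - z0) e1)),
        `|dot (w - z0) e2 - y0| < g / 2 & `|psi (dot (w - z0) e1) - psi x0| < g / 2].
  (* Within sup distance a the ordinate moves by at most 2 a and psi by 2 L a. *)
  move=> g0; pose a := Num.min (r / 8) (g / (8 * (1 + L))).
  have L1 : 0 < 1 + L by lra.
  have a0 : 0 < a by rewrite lt_min !divr_gt0// mulr_gt0.
  have ar : a <= r / 8 by rewrite ge_min lexx.
  have ag : 8 * a * (1 + L) <= g.
    have : a <= g / (8 * (1 + L)) by rewrite ge_min lexx orbT.
    by rewrite ler_pdivlMr ?mulr_gt0//; lra.
  exists a => // w [w1 w2].
  have nw : sup_near (r / 2) w z0.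
    apply: sup_near_le (sup_near_trans _ _ _ _ _ (conj w1 w2) zz).
    by apply: le_trans (lerD ar (lexx _)) _; lra.
  have [xr yr memw] := graph_chartP _ _ _ _ _ _ _ _ _ w C nw; split => //.
    rewrite /y0 -dotBl opprB addrA subrK.
    by apply: le_lt_trans (dot_unit_le e2 (w - z) _ u2 w1 w2) _; nra.
  apply: le_lt_trans (lip _ _ xr x0r) _.
  rewrite /x0 -dotBl opprB addrA subrK.
  by have := dot_unit_le e1 (w - z) _ u1 w1 w2; nra.
have [lt|gt|//] := ltgtP y0 (psi x0).
  exfalso; apply: niz; apply/nbhs_sup_near.
  have [|a a0 H] := near (psi x0 - y0); first by rewrite subr_gt0.
  exists a => // w /H[-> ]; rewrite !ltr_norml; lra.
exfalso; have [|a a0 H] := near (y0 - psi x0); first by rewrite subr_gt0.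
have [w [Ow /H[mem ]]] : Omega `&` [set w | sup_near a w z] !=set0.
  by apply: clz; apply/nbhs_sup_near; exists a.
by move/mem: Ow; rewrite !ltr_norml; lra.
Qed.

Lemma Cs_domain_charts s Omega : 1 <= s -> Cs_domain s Omega ->
  exists2 r : R, 0 < r & forall z0, frontier Omega z0 -> exists2 C : R, 0 <= C &
    exists e1 e2 psi, graph_chart s Omega r C C z0 e1 e2 psi.
Proof.
move=> s1 [r [P [M [r0 P1 M0 H]]]]; exists r => // z0 /H[e1 [e2 [psi [ort Cpsi _ _ mem]]]].
have [L L0 lip] := is_Cs_lipschitz _ _ _ r0 s1 Cpsi.
have [K K0 tan] : exists2 K, 0 <= K & 1 < s -> forall x, `|x| <= r -> exists a,
    forall y, `|y| <= r -> `|psi y - psi x - a * (y - x)| <= K * `|y - x| `^ Num.min s 2.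
  have [s1'|] := ltP 1 s; last by exists 0 => //; lra.
  by have [K K0 tan] := is_Cs_tangent _ _ _ r0 s1' Cpsi; exists K.
exists (L + K); first lra.
exists e1, e2, psi; apply: (graph_chart_mono _ _ _ L K); [lra|lra|split => //].
by move=> x y xr yr; apply: mem => //; apply: le_trans yr _; rewrite ler_pMl// ltW.
Qed.

(** In its own chart a frontier point is on the graph, hence in the domain. *)
Lemma Cs_domain_closed s Omega : 1 <= s -> Cs_domain s Omega -> closed Omega.
Proof.
move=> s1 /(Cs_domain_charts _ _ s1)[r r0 H]; apply/closure_id/seteqP; split.
  exact: subset_closure.
move=> z clz; have [/interior_subset//|niz] := pselect (interior Omega z).
have fz : frontier Omega z by [].
have [C C0 [e1 [e2 [psi ch]]]] := H z fz.
have nz a : 0 < a -> sup_near a z z by move=> a0; split; rewrite subrr normr0 ltW.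
have := frontier_on_graph _ _ _ _ _ _ _ _ _ _ r0 C0 ch fz (nz _ (divr_gt0 r0 _)).
have [|_ _ ->] := graph_chartP _ _ _ _ _ _ _ _ _ z ch; first by apply: nz; rewrite divr_gt0.
by move=> ->.
Qed.

(** Otherwise the points of [Omega] on a segment that joins the two sides would form
    an open and closed part of it. *)
Lemma frontier_meets Omega h k : closed Omega ->
  cell h k `&` Omega !=set0 -> cell h k `&` ~` Omega !=set0 ->
  cell h k `&` frontier Omega !=set0.
Proof.
move=> clO [p [Tp Op]] [q [Tq nOq]]; apply: contrapT => noF.
pose g (t : R) : R * R := (p.1 + t * (q.1 - p.1), p.2 + t * (q.2 - p.2)).
have cg : continuous g.
  have c1 (a b : R) : continuous (fun t : R => a + t * b).
    by move=> t; apply: cvgD; [exact: cvg_cst|apply: cvgM; [exact: cvg_id|exact: cvg_cst]].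
  by move=> t; exact: (cvg_pair (c1 _ _ t) (c1 _ _ t)).
have Tg t : `[0, 1]%classic t -> cell h k (g t).
  rewrite /= in_itv/= => /andP[t0 t1].
  by move: Tp Tq => /cellP[p1 p2] /cellP[q1 q2]; apply/cellP => /=; split; nra.
have intg t : `[0, 1]%classic t -> Omega (g t) -> interior Omega (g t).
  move=> t01 Og; apply: contrapT => ni; apply: noF; exists (g t); split; first exact: Tg.
  by split => //; exact: subset_closure.
have gall : (`[0, 1]%classic `&` g @^-1` Omega) = `[0, 1]%classic.
  apply: (@segment_connected R 0 1).
  - exists 0; split; first by rewrite /= in_itv/= lexx ler01.
    by rewrite /g /= !mul0r !addr0 -surjective_pairing.
  - exists (g @^-1` interior Omega).
      by apply: open_comp; [move=> t _; exact: cg|exact: open_interior].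
    apply/seteqP; split=> t [t01]; first by move=> /(intg _ t01).
    by move=> /interior_subset.
  - by exists (g @^-1` Omega) => //; apply: preimage_closed => // t _; exact: cg.
have : (`[0, 1]%classic : set R) 1 by rewrite /= in_itv/= ler01 lexx.
rewrite -gall => -[_]; rewrite /g /= !mul1r !(addrC p.1) !(addrC p.2) !subrK.
by rewrite -surjective_pairing.
Qed.

(** A frontier point within r/8 of a centre has a whole stencil in the chart around
    this centre when h is small. *)
Definition covering_atlas s Omega r C (zs : seq (R * R)) : Prop :=
  (forall z, frontier Omega z -> exists2 z0, z0 \in zs & sup_near (r / 8) z z0) /\
  (forall z0, z0 \in zs -> exists e1 e2 psi, graph_chart s Omega r C C z0 e1 e2 psi).

(** The frontier is compact, so that finitely many charts suffice, and the sum
    of their constants serves for all. *)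
Lemma Cs_domain_atlas s Omega : 1 <= s -> Omega `<=` unit_square -> Cs_domain s Omega ->
  exists2 r : R, 0 < r & exists2 C : R, 0 <= C & exists zs, covering_atlas s Omega r C zs.
Proof.
move=> s1 OD COm; have [r r0 H] := Cs_domain_charts _ _ s1 COm.
exists r => //.
have cmp : compact (frontier Omega).
  apply: (@subclosed_compact _ _ unit_square).
  - rewrite /frontier setDE; apply: closedI; first exact: closed_closure.
    by rewrite closedC; exact: open_interior.
  - by apply: compact_setX; exact: segment_compact.
  - move=> z [clz _].
    have near (a : R) : 0 < a -> exists2 w, unit_square w & sup_near a w z.
      move=> a0; have [w [Ow wz]] : Omega `&` [set w | sup_near a w z] !=set0.
        by apply: clz; apply/nbhs_sup_near; exists a.
      by exists w => //; exact: OD.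
    have lim (b : R) : (forall a : R, 0 < a -> - a <= b) -> 0 <= b.
      by move=> H'; rewrite leNgt; apply/negP => b0; have := H' (- b / 2); lra.
    rewrite /unit_square /= !in_itv/= -!(subr_ge0 z.1) -!(subr_ge0 z.2).
    split; apply/andP; split; rewrite ?subr_ge0 -1?subr_ge0; apply: lim => a /near[w];
      rewrite /unit_square /= !in_itv/= => -[w1 w2] [];
      rewrite !ler_norml; lra.
have r8 : 0 < r / 8 by rewrite divr_gt0.
have {}cmp : cover_compact (frontier Omega).
  (* Compactness by open covers is stated for pointed spaces. *)
  pose T : ptopologicalType :=
    HB.pack (R * R)%type (isPointed.Build (R * R)%type (0 : R * R)).
  have : @compact T (frontier Omega) by exact: cmp.
  by rewrite compact_cover; exact.
have [|z fz|D DF cov] := cmp _ (frontier Omega) (fun z0 => [set z | ball z0 (r / 8) z]).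
- by move=> z0 _; exact: ball_open.
- by exists z => //; exact: ballxx.
have [C C0 HC] : exists2 C : R, 0 <= C & forall z0, z0 \in (finmap.enum_fset D : seq (R * R)) ->
    exists e1 e2 psi, graph_chart s Omega r C C z0 e1 e2 psi.
  have : forall z0, z0 \in (finmap.enum_fset D : seq (R * R)) -> frontier Omega z0.
    by move=> z0 /DF; rewrite inE.
  elim: (finmap.enum_fset D : seq (R * R)) => [|z0 t IH] ft; first by exists 0.
  have [|C C0 HC] := IH; first by move=> z zt; apply: ft; rewrite inE zt orbT.
  have [|C' C'0 [e1 [e2 [psi HC']]]] := H z0; first by apply: ft; rewrite mem_head.
  exists (C + C'); first exact: addr_ge0.
  move=> z; rewrite inE => /orP[/eqP->|/HC[e1' [e2' [psi' HC'']]]].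
    by exists e1, e2, psi; apply: graph_chart_mono HC'; rewrite lerDr.
  by exists e1', e2', psi'; apply: graph_chart_mono HC''; rewrite lerDl.
exists C => //; exists (finmap.enum_fset D : seq (R * R)); split => // z fz.
have [z0 Dz0 [b1 b2]] := cov z fz; exists z0 => //.
by split; rewrite distrC; exact: ltW.
Qed.

End Atlas.

(** * Singular cells: tangent half-planes and counting *)

Section SingularCells.
Context {R : realType}.
Implicit Types (z w e d n : R * R) (Omega : set (R * R)) (r L K C s h : R) (psi : R -> R).
Local Notation RB := (measurableTypeR R).
Local Notation PB := (RB * RB)%type.

Lemma stencil_sup_near h k (a b : int) z w : 0 < h -> -1 <= a <= 1 -> -1 <= b <= 1 ->
  cell h k z -> open_cell h (k.1 + a, k.2 + b) w -> sup_near (2 * h) w z.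
Proof.
move=> h0; rewrite -!(ler_int R) => ha hb /cellP[z1 z2] /open_cellP/=.
by rewrite !intrD => -[w1 w2]; split; rewrite ler_norml; nra.
Qed.

Lemma between_graph_and_tangent (y t dy x m del : R) :
  `|y - t - m * x| <= del -> (dy <= y <-> ~ dy - t - m * x <= 0) ->
  `|dy - t - m * x| <= del.
Proof.
rewrite !ler_norml => tw [below above].
have [H|H] := lerP (dy - t - m * x) 0.
  have [dyy|dyy] := leP dy y; first by have := below dyy; rewrite H.
  by lra.
have : dy <= y by apply: above; rewrite leNgt H.
by lra.
Qed.

(** The half-plane below the tangent at [z].  A point of the stencil where it differs
    from [Omega] lies between the tangent and the graph, hence in a strip around the
    tangent of the width given by the Taylor remainder at distance 4 h. *)
Lemma tangent_half_plane s Omega r C z0 e1 e2 psi h k z : 0 < r -> 0 <= C -> 1 < s ->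
  0 < h -> 2 * h <= r / 8 -> measurable (Omega : set PB) ->
  graph_chart s Omega r C C z0 e1 e2 psi -> frontier Omega z -> cell h k z ->
  sup_near (r / 8) z z0 ->
  exists n c H, [/\ half_plane n c H, [set w | dot n w = c] `&` cell h k !=set0 &
    forall a b : int, -1 <= a <= 1 -> -1 <= b <= 1 ->
      symdiff_mass h (k.1 + a, k.2 + b) Omega H <= 8 * C * h * (4 * h) `^ Num.min s 2].
Proof.
move=> r0 C0 s1 h0 hr mO ch fz cz zz0; have [ort lip _ tan] := ch.
have [u1 u2 u12] := ort.
have yx := frontier_on_graph _ _ _ _ _ _ _ _ _ _ r0 C0 ch fz zz0.
have nz : sup_near (r / 2) z z0 by case: zz0 => z1 z2; split; lra.
have [x0r _ _] := graph_chartP _ _ _ _ _ _ _ _ _ z ch nz.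
set x0 := dot (z - z0) e1 in yx x0r.
have rho0 : 0 <= Num.min s 2 by rewrite le_min (le_trans ler01 (ltW s1)) ler0n.
have [m Hm] := tan s1 x0 x0r.
pose n := e2 - m *: e1; pose c := dot n z.
have dn w : dot n w = dot w e2 - m * dot w e1 by rewrite /n /dot/= /GRing.scale/=; ring.
have nn : 1 <= dot n n.
  have -> : dot n n = dot e2 e2 + m ^+ 2 * dot e1 e1 - 2 * m * dot e1 e2.
    by rewrite /n /dot/= /GRing.scale/=; ring.
  by rewrite u1 u2 u12; have := sqr_ge0 m; lra.
have n0 : n != 0.
  by apply: contraTneq nn => ->; rewrite /dot/= !mul0r addr0 -ltNge ltr01.
pose H := [set w | dot n w <= c].
have hp : half_plane n c H by split => //; left.
have mH := measurable_half_plane _ _ _ hp.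
exists n, c, H; split => //; first by exists z.
move=> a b ha hb; set del := C * (4 * h) `^ Num.min s 2.
have del0 : 0 <= del by rewrite mulr_ge0// powR_ge0.
have strp w : open_cell h (k.1 + a, k.2 + b) w -> (Omega w <-> ~ H w) -> strip n c del w.
  move=> ow; have [w1 w2] := stencil_sup_near _ _ _ _ _ _ h0 ha hb cz ow.
  have nw : sup_near (r / 2) w z0.
    apply: sup_near_le (sup_near_trans _ _ _ _ _ (conj w1 w2) zz0).
    by apply: le_trans (lerD hr (lexx _)) _; lra.
  have [xr _ memw] := graph_chartP _ _ _ _ _ _ _ _ _ w ch nw.
  have dx : `|dot (w - z0) e1 - x0| <= 4 * h.
    rewrite /x0 -dotBl opprB addrA subrK.
    apply: le_trans (dot_unit_le e1 (w - z) _ u1 w1 w2) _.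
    by rewrite mulrA -natrM.
  have tw : `|psi (dot (w - z0) e1) - psi x0 - m * (dot (w - z0) e1 - x0)| <= del.
    apply: le_trans (Hm _ xr) _; rewrite /del ler_wpM2l//.
    by apply: powR_le_powR; rewrite ?normr_ge0.
  have E : dot n w - c = dot (w - z0) e2 - psi x0 - m * (dot (w - z0) e1 - x0).
    by rewrite -yx /c /x0 !dn !dotBl; ring.
  rewrite /strip/= E memw /H/= -[dot n w <= c]subr_le0 E.
  exact: between_graph_and_tangent.
have ms := measurable_strip n c del.
have bound := mass_strip h (k.1 + a, k.2 + b) n c del h0 del0 nn.
have m1 : mass h (k.1 + a, k.2 + b) (Omega `\` H) <= 4 * h * del.
  apply: le_trans bound; apply: mass_le => //; first exact: measurableD.
  by move=> w [ow [Ow nH]]; apply: strp.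
have m2 : mass h (k.1 + a, k.2 + b) (H `\` Omega) <= 4 * h * del.
  apply: le_trans bound; apply: mass_le => //; first exact: measurableD.
  by move=> w [ow [Ow nH]]; apply: strp.
apply: le_trans (lerD m1 m2) _.
by rewrite le_eqVlt; apply/orP; left; apply/eqP; rewrite /del; ring.
Qed.

(** The offsets from any fixed element embed the set into a square of side 2 q + 1. *)
Lemma card_clustered (N q : nat) (F : {set 'I_N * 'I_N}) :
  (forall k k', k \in F -> k' \in F -> k.1 <= k'.1 + q /\ k.2 <= k'.2 + q)%N ->
  (#|F| <= (q.*2.+1) ^ 2)%N.
Proof.
move=> Fq; have [->|/set0Pn[a aF]] := eqVneq F finset.set0; first by rewrite cards0.
pose f (k : 'I_N * 'I_N) : 'I_(q.*2.+1) * 'I_(q.*2.+1) :=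
  (inord (k.1 + q - a.1), inord (k.2 + q - a.2)).
rewrite -(@card_in_imset _ _ f).
  by rewrite (leq_trans (max_card _))// card_prod card_ord expnS expn1.
move=> k k' kF k'F [/(congr1 val)/= e1 /(congr1 val)/= e2].
have [a1 a2] := Fq _ _ aF kF; have [b1 b2] := Fq _ _ kF aF.
have [c1 c2] := Fq _ _ aF k'F; have [d1 d2] := Fq _ _ k'F aF.
have bnd (x y : nat) : (x <= y + q)%N -> (x + q - y < q.*2.+1)%N by lia.
have inj (x x' y : nat) : (y <= x + q)%N -> (y <= x' + q)%N ->
    (x + q - y = x' + q - y)%N -> x = x' by lia.
move: e1 e2; rewrite !inordK ?bnd// => /(inj _ _ _ a1 c1) e1 /(inj _ _ _ a2 c2) e2.
by rewrite [k]surjective_pairing [k']surjective_pairing; congr pair; apply: val_inj.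
Qed.

Lemma card_by_bins (I : finType) (S : {set I}) (B Q : nat) (bin : I -> nat) :
  (forall k, k \in S -> bin k < B)%N ->
  (forall j, #|[set k in S | bin k == j]| <= Q)%N -> (#|S| <= B * Q)%N.
Proof.
elim: B S => [|B IH] S SB SQ.
  by rewrite leqn0 cards_eq0; apply/eqP/finset.setP => k; rewrite finset.in_set0; apply/negP => /SB.
rewrite -(cardsID [set k in S | bin k == B] S) mulSn leq_add//.
  by apply: leq_trans (SQ B); apply: subset_leq_card; apply/fintype.subsetP => k; rewrite !inE => /andP[].
apply: IH => [k|j].
  rewrite !inE => /andP[nk kS]; have := SB k kS.
  by rewrite ltnS leq_eqVlt => /orP[kB|//]; move: nk; rewrite kS kB.
apply: leq_trans (SQ j); apply: subset_leq_card; apply/fintype.subsetP => k.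
by rewrite !inE => /andP[/andP[_ ->]].
Qed.

(** Cells are sorted by the abscissa, in units of h, of a frontier point that they
    contain.  Frontier points with the same integer part of the abscissa are at
    distance O(h), by the Lipschitz bound, so that their cells are clustered. *)
Lemma singular_count_chart s Omega r C z0 e1 e2 psi (N : nat) h
    (S : {set 'I_N * 'I_N}) : 0 < r -> 0 <= C -> 0 < h -> h <= 1 ->
  graph_chart s Omega r C C z0 e1 e2 psi ->
  (forall k, k \in S -> exists z, [/\ frontier Omega z, cell h (mesh_index k) z &
     sup_near (r / 8) z z0]) ->
  #|S|%:R * h <= (2 * r + 1) * ((Num.truncn (C + 2)).*2.+1 ^ 2)%:R.
Proof.
move=> r0 C0 h0 h1 ch HS; have [ort lip _ _] := ch.
have [u1 u2 _] := ort.
have [|zf Hzf] := @choice _ _ (fun k z => k \in S ->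
    [/\ frontier Omega z, cell h (mesh_index k) z & sup_near (r / 8) z z0]).
  move=> k; have [kS|kS] := boolP (k \in S); last by exists z0.
  by have [z Hz] := HS k kS; exists z.
pose X k := dot (zf k - z0) e1.
pose bin k := Num.truncn ((X k + r) / h).
pose B := (Num.truncn (2 * r / h)).+1.
(* Frontier points of one bin are at sup distance (1 + C) h, and a point determines
   the index of its cell up to 1, so that the indices differ by at most C + 2. *)
pose q := Num.truncn (C + 2).
have Xr k : k \in S -> `|X k| <= r.
  move=> /Hzf[_ _ [n1 n2]].
  by apply: le_trans (dot_unit_le e1 (zf k - z0) _ u1 n1 n2) _; lra.
have count : (#|S| <= B * (q.*2.+1 ^ 2))%N.
  apply: (card_by_bins _ _ _ _ bin).
    move=> k kS; rewrite ltnS; apply: le_truncn; rewrite ler_pM2r ?invr_gt0//.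
    by have := Xr k kS; rewrite ler_norml; lra.
  move=> j; apply: card_clustered => k k'; rewrite !inE => /andP[kS /eqP kj] /andP[k'S /eqP k'j].
  have Xk : `|X k - X k'| <= h.
    have pos l : l \in S -> 0 <= (X l + r) / h.
      by move=> lS; apply: divr_ge0 (ltW h0); have := Xr l lS; rewrite ler_norml; lra.
    have /andP[t1 t2] := truncn_itv (pos k kS).
    have /andP[t1' t2'] := truncn_itv (pos k' k'S).
    rewrite -/(bin k) kj in t1 t2; rewrite -/(bin k') k'j in t1' t2'.
    move: t1 t2 t1' t2'; rewrite !ler_pdivlMr// !ltr_pdivrMr// -!natr1.
    by rewrite ler_norml; lra.
  have [fk ck nk] := Hzf k kS; have [fk' ck' nk'] := Hzf k' k'S.
  have Yk := frontier_on_graph _ _ _ _ _ _ _ _ _ _ r0 C0 ch fk nk.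
  have Yk' := frontier_on_graph _ _ _ _ _ _ _ _ _ _ r0 C0 ch fk' nk'.
  have DY : `|dot (zf k - z0) e2 - dot (zf k' - z0) e2| <= C * h.
    rewrite Yk Yk'; apply: le_trans (lip _ _ (Xr k kS) (Xr k' k'S)) _.
    by rewrite ler_wpM2l.
  have [D1 D2] : sup_near ((1 + C) * h) (zf k) (zf k').
    have E : zf k - zf k' = (X k - X k') *: e1 +
        (dot (zf k - z0) e2 - dot (zf k' - z0) e2) *: e2.
      rewrite {1}(orthonormal_expand _ _ (zf k - zf k') ort) /X -!dotBl.
      by rewrite !opprB !addrA !subrK.
    have le1 e : dot e e = 1 -> `|e.1| <= 1 /\ `|e.2| <= 1.
      rewrite /dot => ee.
      by split; rewrite -(@ler_pXn2r _ 2)// ?nnegrE// real_normK ?num_real// expr1n; nra.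
    have [e11 e12] := le1 e1 u1; have [e21 e22] := le1 e2 u2.
    have key (x y a b : R) : `|x| <= h -> `|y| <= C * h -> `|a| <= 1 -> `|b| <= 1 ->
        `|x * a + y * b| <= (1 + C) * h.
      move=> hx hy ha hb; apply: le_trans (ler_normD _ _) _; rewrite !normrM.
      have := normr_ge0 x; have := normr_ge0 y; nra.
    by split; [have := congr1 fst E|have := congr1 snd E] => /= ->; apply: key.
  have conv (i j' : 'I_N) (x y : R) : h * i%:R <= x <= h * i%:R + h ->
      h * j'%:R <= y <= h * j'%:R + h -> `|x - y| <= (1 + C) * h -> (i <= j' + q)%N.
    move=> hx hy; rewrite ler_norml => hxy.
    have : h * (i%:R - j'%:R) <= h * (C + 2) by lra.
    rewrite ler_pM2l// => iC; have [ij|ij] := leqP i j'; first exact: leq_trans ij (leq_addr _ _).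
    rewrite -leq_subLR; have C2 : 0 <= C + 2 by lra.
    by rewrite /q truncn_ge_nat// natrB// ltnW.
  move: ck ck' => /cellP[k1 k2] /cellP[k1' k2'].
  by split; [apply: conv k1 k1' D1|apply: conv k2 k2' D2].
apply: (@le_trans _ _ ((B * q.*2.+1 ^ 2)%:R * h)).
  by rewrite ler_pM2r// ler_nat.
rewrite natrM mulrAC ler_wpM2r// /B -natr1 mulrDl mul1r.
apply: lerD => //.
have rh : 0 <= 2 * r / h by apply: divr_ge0 (ltW h0); lra.
by rewrite -ler_pdivlMr//; have /andP[] := truncn_itv rh.
Qed.

Lemma singular_count s Omega r C zs (N : nat) h (S : {set 'I_N * 'I_N}) :
  0 < r -> 0 <= C -> 0 < h -> h <= 1 -> covering_atlas s Omega r C zs ->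
  (forall k, k \in S -> cell h (mesh_index k) `&` frontier Omega !=set0) ->
  #|S|%:R * h <= (size zs)%:R * ((2 * r + 1) * ((Num.truncn (C + 2)).*2.+1 ^ 2)%:R).
Proof.
move=> r0 C0 h0 h1 [cov ch] HS; set A := (X in _ <= _ * X).
have A0 : 0 <= A by rewrite mulr_ge0//; lra.
pose P (z0 : R * R) (k : 'I_N * 'I_N) := `[< exists z, [/\ frontier Omega z,
  cell h (mesh_index k) z & sup_near (r / 8) z z0] >].
have : forall k, k \in S -> exists2 z0, z0 \in zs & P z0 k.
  move=> k /HS[z [cz fz]]; have [z0 z0s nz] := cov z fz; exists z0 => //.
  by apply/asboolP; exists z.
have {}ch : forall z0, z0 \in zs -> forall S' : {set 'I_N * 'I_N},
    (forall k, k \in S' -> P z0 k) -> #|S'|%:R * h <= A.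
  move=> z0 /ch[e1 [e2 [psi hc]]] S' HS'; apply: singular_count_chart hc _ => //.
  by move=> k /HS' /asboolP.
clear cov HS; elim: zs S ch => [|z0 zs IH] S ch HS.
  have -> : S = finset.set0.
    by apply/finset.setP => k; rewrite finset.in_set0; apply/negP => /HS[].
  by rewrite cards0 !mul0r.
rewrite -(cardsID [set k | P z0 k] S) natrD mulrDl /= -natr1 addrC mulrDl mul1r.
apply: lerD; last first.
  by apply: (ch z0 (mem_head _ _)) => k /finset.setIP[_]; rewrite finset.in_set.
apply: IH => [z zz|k].
  by apply: ch; rewrite inE zz orbT.
rewrite !inE => /andP[nP kS]; have [z] := HS k kS.
by rewrite inE => /orP[/eqP ->|zz Pz]; [rewrite (negbTE nP)|exists z].
Qed.

End SingularCells.

(** * From cell errors to the L1 error *)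

Section GlobalError.
Context {R : realType}.
Implicit Types (z w : R * R) (Omega A : set (R * R)) (h : R) (N : nat).
Local Notation RB := (measurableTypeR R).
Local Notation PB := (RB * RB)%type.

Lemma mesh_cover N h z : (0 < N)%N -> h = N%:R^-1 -> unit_square z ->
  exists k : 'I_N * 'I_N, cell h (mesh_index k) z.
Proof.
move=> N0 hN; have h0 : 0 < h by rewrite hN invr_gt0 ltr0n.
have key (x : R) : 0 <= x <= 1 -> exists i : 'I_N, h * i%:R <= x <= h * i%:R + h.
  move=> /andP[x0 x1]; have [x1'|x1'] := ltP x 1.
    have hx : 0 <= x / h by apply: divr_ge0 (ltW h0).
    have /andP[t1 t2] := truncn_itv hx.
    have iN : (Num.truncn (x / h) < N)%N.
      by rewrite truncn_lt_nat// hN invrK -[ltRHS]mul1r ltr_pM2r// ltr0n.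
    exists (Ordinal iN); rewrite /= -[X in _ <= _ <= _ + X]mulr1 -mulrDr natr1.
    rewrite mulrC -ler_pdivlMr// t1 mulrC -ler_pdivrMr//; exact: ltW.
  have iN : (N.-1 < N)%N by rewrite prednK.
  exists (Ordinal iN); rewrite /=.
  have E : h * N.-1%:R + h = 1.
    by rewrite -[X in _ + X]mulr1 -mulrDr natr1 prednK// hN mulVf// pnatr_eq0 -lt0n.
  by lra.
rewrite /unit_square /= !in_itv/= => -[/key[i hi] /key[j hj]].
by exists (i, j); apply/cellP.
Qed.

Lemma open_cell_disjoint N h (k k' : 'I_N * 'I_N) z : 0 < h ->
  open_cell h (mesh_index k) z -> cell h (mesh_index k') z -> k' = k.
Proof.
move=> h0 /open_cellP[z1 z2] /cellP[c1 c2].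
have key (i j : 'I_N) (x : R) : h * i%:R < x < h * i%:R + h ->
    h * j%:R <= x <= h * j%:R + h -> j = i.
  move=> oi cj; apply: val_inj => /=.
  have : h * i%:R < h * (j%:R + 1) by lra.
  have : h * j%:R < h * (i%:R + 1) by lra.
  rewrite !ltr_pM2l// !natr1 !ltr_nat !ltnS => ji ij.
  by apply/eqP; rewrite eqn_leq ji ij.
rewrite [k']surjective_pairing [k]surjective_pairing; congr pair.
  exact: key z1 c1.
exact: key z2 c2.
Qed.

(** Off the lines of the grid exactly one term of the reconstruction is present. *)
Lemma reconstruction_error N h (p : 'I_N * 'I_N -> R * R -> R) Omega
    (E : 'I_N * 'I_N -> set (R * R)) : (0 < N)%N -> h = N%:R^-1 ->
  measurable (Omega : set PB) -> (forall k, measurable (E k : set PB)) ->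
  (forall k, measurable_fun setT (p k : PB -> RB)) ->
  (forall k z, `|\1_Omega z - p k z| = \1_(E k) z) ->
  (Lnorm_on area unit_square 1
    (fun z => (\1_Omega z - global_reconstruction h p z)%R)
    <= (\sum_k mass h (mesh_index k) (E k))%:E)%E.
Proof.
move=> N0 hN mO mE mp pE; have h0 : 0 < h by rewrite hN invr_gt0 ltr0n.
pose F z : R := \1_Omega z - global_reconstruction h p z.
pose oE k := open_cell h (mesh_index k) `&` E k.
have moE k : measurable (oE k : set PB).
  by apply: measurableI => //; exact: measurable_open_cell.
have mF : measurable_fun setT (F : PB -> RB).
  apply: measurable_funB; first exact: measurable_indic.
  apply: measurable_sum => k; apply: measurable_funM.
  - exact: mp.
  - by apply: measurable_indic; exact: measurable_cell.
have mD : measurable (unit_square : set PB) by apply: measurableX.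
rewrite /Lnorm_on Lnorm1.
apply: (@le_trans _ _ (\int[area]_z (\sum_k (\1_(oE k) z)%:E))%E); last first.
  rewrite ge0_integral_sum//.
  - rewrite -sumEFin; apply: lee_sum => k _.
    by rewrite integral_indic// setIT area_massE.
  - by move=> k; apply/measurable_EFinP; exact: measurable_indic.
apply: ae_ge0_le_integral => //.
- by apply: measurableT_comp => //; apply/measurable_EFinP; apply/measurable_restrict => //;
    rewrite setTI; exact: measurable_funTS.
- by move=> z _; apply: sume_ge0 => k _; rewrite lee_fin.
- by apply: emeasurable_sum => k; apply/measurable_EFinP; exact: measurable_indic.
pose Z : set (R * R) := \big[setU/set0]_(k : 'I_N * 'I_N) (cell h (mesh_index k) `&` ~` open_cell h (mesh_index k)).
have mZk (k : int * int) : measurable (cell h k `&` ~` open_cell h k : set PB).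
  by apply: measurableI; [exact: measurable_cell|apply: measurableC; exact: measurable_open_cell].
exists Z; split.
- by apply: bigsetU_measurable => k _; exact: mZk.
- rewrite /Z; elim: (index_enum _) => [|k t IH]; first by rewrite big_nil measure0.
  rewrite big_cons measureU0//.
  + rewrite area_cellI//; last by apply: measurableC; exact: measurable_open_cell.
    by rewrite setICr measure0.
  + by apply: bigsetU_measurable => j _; exact: mZk.
- move=> z /= zbad; apply: contrapT => nZ; apply: zbad => _.
  rewrite patchE; case: ifPn => [|_]; last first.
    by rewrite normr0 sume_ge0// => k _; rewrite lee_fin.
  rewrite inE => Dz; have [k ck] := mesh_cover N h z N0 hN Dz.
  have ok : open_cell h (mesh_index k) z.
    apply: contrapT => nok; apply: nZ; rewrite /Z -bigcup_seq.
    by exists k => //=; rewrite mem_index_enum.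
  have -> : global_reconstruction h p z = p k z.
    rewrite /global_reconstruction (bigD1 k)//= big1 => [|k' k'k].
      by rewrite indicE mem_set// mulr1 addr0.
    rewrite indicE memNset ?mulr0// => /(open_cell_disjoint N h k k' z h0 ok) E'.
    by rewrite E' eqxx in k'k.
  rewrite pE (bigD1 k)//= -[leLHS]adde0; apply: leeD.
    rewrite lee_fin !indicE; have [Ez|Ez] := pselect (E k z).
      by rewrite !mem_set.
    by rewrite memNset.
  by apply: sume_ge0 => k' _; rewrite lee_fin.
Qed.

End GlobalError.

(** * The convergence rate *)

Section CellErrors.
Context {R : realType}.
Implicit Types (z w : R * R) (Omega A : set (R * R)) (h : R).
Local Notation RB := (measurableTypeR R).
Local Notation PB := (RB * RB)%type.

Definition has_error_set Omega (v : R * R -> R) A : Prop :=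
  [/\ measurable (A : set PB), measurable_fun setT (v : PB -> RB) &
      forall z, `|\1_Omega z - v z| = \1_A z].

Lemma indic_error_set Omega A : measurable (Omega : set PB) -> measurable (A : set PB) ->
  has_error_set Omega \1_A ((Omega `\` A) `|` (A `\` Omega)).
Proof.
move=> mO mA; split.
- by apply: measurableU; exact: measurableD.
- exact: measurable_indic.
- move=> z; rewrite !indicE in_setU !in_setD.
  by case: (z \in Omega); case: (z \in A); rewrite /= ?subrr ?subr0 ?sub0r ?normrN ?normr0 ?normr1.
Qed.

Lemma mass_symdiff_le h k A B : 0 < h -> measurable (A : set PB) -> measurable (B : set PB) ->
  mass h k ((A `\` B) `|` (B `\` A)) <= symdiff_mass h k A B.
Proof.
move=> h0 mA mB; apply: mass_leU => //; try exact: measurableD.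
  by apply: measurableU; exact: measurableD.
Qed.

Lemma mass_eq0 h k A : 0 < h -> measurable (A : set PB) ->
  area (cell h k `&` A) = 0%E -> mass h k A = 0.
Proof. by move=> h0 mA; rewrite area_cellI// /mass => ->. Qed.

(** On a regular cell the average is 0 or 1, and the error is the indicator of
    [Omega] or of its complement, whichever is negligible there. *)
Lemma regular_error_set h k Omega v : 0 < h -> measurable (Omega : set PB) ->
  lvira_local h k Omega v -> ~ singular (cell h k) Omega ->
  exists2 A, has_error_set Omega v A & mass h k A = 0.
Proof.
move=> h0 mO [_ reg] nsing; have {reg}-> := reg nsing.
have h2 : h ^+ 2 != 0 by rewrite expf_neq0// gt_eqF.
have mCO : measurable (~` Omega : set PB) by exact: measurableC.
have full : mass h k Omega + mass h k (~` Omega) = h ^+ 2.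
  rewrite -(mass_full h k setT h0 (@subsetT _ _)) (mass_split h k setT Omega)//.
  by rewrite setTI setTD.
rewrite average_indic//.
have [m0|m0] : mass h k Omega = 0 \/ mass h k (~` Omega) = 0.
  have [e0|e0] := eqVneq (area (cell h k `&` Omega)) 0%E; first by left; apply: mass_eq0.
  have [e1|e1] := eqVneq (area (cell h k `&` ~` Omega)) 0%E; first by right; apply: mass_eq0.
  by exfalso; apply: nsing.
- exists Omega => //; split => //.
  by move=> z; rewrite m0 mul0r subr0 ger0_norm.
- exists (~` Omega) => //; split => //.
  move=> z; have -> : mass h k Omega = h ^+ 2 by rewrite -full m0 addr0.
  rewrite divff//= !indicE in_setC.
  by case: (z \in Omega); rewrite ?subrr ?normr0// sub0r normrN normr1.
Qed.

Lemma singular_error_set h k Omega v : 0 < h -> measurable (Omega : set PB) ->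
  lvira_local h k Omega v -> singular (cell h k) Omega ->
  exists2 A, has_error_set Omega v A & mass h k A <= h ^+ 2.
Proof.
move=> h0 mO [sing _] sk; have [[n [c [H [hp _ ->]]]] _] := sing sk.
have mH := measurable_half_plane _ _ _ hp.
have HA := indic_error_set _ _ mO mH.
by eexists; [exact: HA|apply: mass_le_full => //; have [] := HA].
Qed.

Lemma singular_frontier h k Omega : closed Omega -> singular (cell h k) Omega ->
  cell h k `&` frontier Omega !=set0.
Proof.
move=> clO [n1 n2]; apply: frontier_meets => //; apply/set0P.
- by apply: contra_neq n1 => ->; rewrite measure0.
- by apply: contra_neq n2 => ->; rewrite measure0.
Qed.

Lemma singular_error_set_tangent s r C zs h k Omega v : 0 < r -> 0 <= C -> 1 < s ->
  0 < h -> 2 * h <= r / 8 -> closed Omega -> covering_atlas s Omega r C zs ->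
  lvira_local h k Omega v -> singular (cell h k) Omega ->
  exists2 A, has_error_set Omega v A &
    mass h k A <= 200 * C * h * (4 * h) `^ Num.min s 2.
Proof.
move=> r0 C0 s1 h0 hr clO [cov ch] [sing _] sk.
have mO := measurable_closed _ clO.
have [z [cz fz]] := singular_frontier _ _ _ clO sk.
have [z0 z0s nz] := cov z fz; have [e1 [e2 [psi hc]]] := ch z0 z0s.
have [n [c [H0 [hp T0 HM]]]] := tangent_half_plane _ _ _ _ _ _ _ _ _ k z r0 C0 s1 h0 hr mO hc fz cz nz.
have [H mH [-> err]] := lvira_error _ _ _ _ _ _ _ _ h0 mO hp T0 HM (sing sk).
have HA := indic_error_set _ _ mO mH.
eexists; first exact: HA.
apply: le_trans (mass_symdiff_le h k _ _ h0 mO mH) _; apply: le_trans err _.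
by rewrite le_eqVlt; apply/orP; left; apply/eqP; ring.
Qed.

End CellErrors.

Theorem corollary3p3 (R : realType) (s : R) (Omega : set (R * R))
  (hs : 1 <= s) (hD : Omega `<=` unit_square) (hOmega : Cs_domain s Omega) :
  exists C : R, forall (N0 : nat) (h : R) (p : 'I_N0 * 'I_N0 -> R * R -> R),
    (1 < N0)%N -> h = N0%:R^-1 ->
    (forall k, lvira_local h (mesh_index k) Omega (p k)) ->
    (Lnorm_on area unit_square 1
       (fun z : R * R => (\1_Omega z - global_reconstruction h p z)%R) <= (C * h `^ Num.min s 2)%:E)%E.
Proof.
have clO := Cs_domain_closed _ _ hs hOmega.
have mO := measurable_closed _ clO.
have [r r0 [C C0 [zs atlas]]] := Cs_domain_atlas _ _ hs hD hOmega.
(* A bounds h times the number of singular cells. *)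
pose A := (size zs)%:R * ((2 * r + 1) * ((Num.truncn (C + 2)).*2.+1 ^ 2)%:R).
have A0 : 0 <= A by rewrite mulr_ge0// mulr_ge0//; lra.
pose rho := Num.min s 2.
pose C1 := 200 * C * 4 `^ rho.
pose C2 := ((r / 16) `^ rho)^-1.
have C10 : 0 <= C1 by rewrite mulr_ge0 ?powR_ge0// mulr_ge0.
have C20 : 0 <= C2 by rewrite invr_ge0 powR_ge0.
exists (A * (1 + C1 + C2)) => N h p N1 hN Hp.
have N0 : (0 < N)%N by exact: ltnW.
have h0 : 0 < h by rewrite hN invr_gt0 ltr0n.
have h1 : h <= 1 by rewrite hN invf_le1 ?ltr0n// ler1n.
(* M bounds the error on a singular cell: h^2 when s = 1, and also when h is too
   coarse for the charts, as it is then at least r / 16; otherwise the bound given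
   by the tangents. *)
have [M [M0 Mh Merr]] : exists M : R, [/\ 0 <= M, M <= (1 + C1 + C2) * h * h `^ rho &
    forall k, singular (cell h (mesh_index k)) Omega ->
      exists2 B, has_error_set Omega (p k) B & mass h (mesh_index k) B <= M].
  have hrho : 0 <= h `^ rho by exact: powR_ge0.
  have [s1|s1] := leP s 1.
    have s1' : s = 1 by lra.
    exists (h ^+ 2); split; first by rewrite exprn_ge0// ltW.
      have -> : h `^ rho = h.
        by rewrite /rho s1' (min_idPl _) ?powRr1 ?ler1n// ltW.
      have := mulr_ge0 (ltW h0) (ltW h0); rewrite expr2; nra.
    by move=> k; exact: singular_error_set.
  have [hr|hr] := leP (2 * h) (r / 8).
    exists (200 * C * h * (4 * h) `^ rho); split.
    - by rewrite !mulr_ge0 ?powR_ge0// ltW.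
    - have -> : (4 * h) `^ rho = 4 `^ rho * h `^ rho by rewrite powRM// ltW.
      rewrite (_ : 200 * C * h * _ = C1 * (h * h `^ rho)); last by rewrite /C1; ring.
      have := mulr_ge0 (ltW h0) hrho; nra.
    - by move=> k; exact: singular_error_set_tangent r0 C0 s1 h0 hr clO atlas (Hp k).
  exists (h ^+ 2); split; first by rewrite exprn_ge0// ltW.
    have r16 : 0 < r / 16 by rewrite divr_gt0.
    have rr : (r / 16) `^ rho <= h `^ rho.
      apply: powR_le_powR; first by rewrite /rho le_min; lra.
      by lra.
    have c2 : 1 <= C2 * h `^ rho.
      by rewrite /C2 mulrC ler_pdivlMr ?powR_gt0// mul1r.
    have := mulr_ge0 (ltW h0) hrho; rewrite expr2; nra.
  by move=> k; exact: singular_error_set.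
pose S := [set k : 'I_N * 'I_N | `[< singular (cell h (mesh_index k)) Omega >]]%SET.
have /choice[E HE] : forall k, exists B, has_error_set Omega (p k) B /\
    mass h (mesh_index k) B <= (if k \in S then M else 0).
  move=> k; rewrite finset.in_set; case: asboolP => [sk|nsk].
    by have [B HB mB] := Merr k sk; exists B.
  have [B HB mB] := regular_error_set _ _ _ _ h0 mO (Hp k) nsk.
  by exists B; rewrite mB.
apply: le_trans (reconstruction_error _ _ _ _ E N0 hN mO _ _ _) _.
- by move=> k; have [[]] := HE k.
- by move=> k; have [[]] := HE k.
- by move=> k; have [[]] := HE k.
rewrite lee_fin; apply: (@le_trans _ _ (\sum_k (if k \in S then M else 0))).
  by apply: ler_sum => k _; have [] := HE k.
rewrite -big_mkcond/= sumr_const -[M *+ _]mulr_natl.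
have cnt := singular_count _ _ _ _ _ N h S r0 C0 h0 h1 atlas.
have {}cnt : #|S|%:R * h <= A.
  by apply: cnt => k; rewrite finset.in_set => /asboolP; exact: singular_frontier.
apply: (@le_trans _ _ (#|S|%:R * ((1 + C1 + C2) * h * h `^ rho))).
  by rewrite ler_wpM2l.
rewrite [leLHS](_ : _ = (#|S|%:R * h) * ((1 + C1 + C2) * h `^ rho)); last by ring.
rewrite -[leRHS]mulrA; apply: ler_wpM2r => //.
by rewrite mulr_ge0 ?powR_ge0//; lra.
Qed.
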